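(* Let $(X_n)_{n\geq 1}$ and $X$ be random elements in $\mathbb{D}([0,1];\mathbb{D})$ defined on the same probability space, and let $T_X=\{t \in [0,1]: P(X(t)=X(t-))=1\}$. Suppose that: a) $\big(X_n(t_1),\ldots,X_n(t_k) \big) \stackrel{d}{\to} \big(X(t_1),\ldots,X(t_k) \big)$ in $\mathbb{D}^k$, for any $k\ge1$ and any $t_1,\ldots,t_k \in T_X$; b) $d_{J_1}^0\big(X(1),X(1-\delta)\big) \to 0$ in probability as $\delta \to 0$; c) for any $\varepsilon>0$, $$\lim_{\delta \to 0} \limsup_{n\to \infty} P\big(w''(X_n(t),\delta )\geq \varepsilon \text{ for some } t \in [0,1] \big)=0,$$ $$\lim_{\delta \to 0}\limsup_{n \to \infty}P\big(|X_n(t,\delta)-X_n(t,0)| \geq \varepsilon \text{ for some } t \in [0,1]\big)=0,$$ $$\lim_{\delta \to 0}\limsup_{n \to \infty}P\big(|X_n(t,1-)-X_n(t,1-\delta)| \geq \varepsilon \text{ for some } t \in [0,1]\big)=0.$$ If there exist $\alpha >1/2$, $\beta \geq 0$ and a non-decreasing continuous function $F$ on $[0,1]$ such that for any $r,s,t \in [0,1]$ with $r \leq s \leq t$, for any $\lambda>0$ and for any $n\geq 1$, $$P\big(d_{J_1}^0(X_n(r),X_n(s)) \wedge d_{J_1}^0(X_n(s),X_n(t)) \geq \lambda \big) \leq \frac{1}{\lambda^{4\beta}}[F(t)-F(r)]^{2\alpha},$$ then $X_n \stackrel{d}{\to} X$ in $\mathbb{D}([0,1];\mathbb{D})$ equipped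 with $d_{\mathbb{D}}$.
   Context: $\mathbb{D}$ is the set of functions $x:[0,1]\to\mathbb{R}$ that are right-continuous and have left limits, with $\|x\|=\sup_{s\in[0,1]}|x(s)|$. $\Lambda$ is the set of strictly increasing continuous functions from $[0,1]$ onto $[0,1]$, $e$ is the identity on $[0,1]$, and for $\lambda\in\Lambda$, $\|\lambda\|^0=\sup_{s<s'}\left|\log\frac{\lambda(s')-\lambda(s)}{s'-s}\right|$. The Skorohod $J_1$-topology on $\mathbb{D}$ is given by the (complete, separable) metric $d_{J_1}^0(x,y)=\inf_{\lambda\in\Lambda}\{\|\lambda\|^0\vee\|x-y\circ\lambda\|\}$; $\mathbb{D}^k$ carries the product topology. $\mathbb{D}([0,1];\mathbb{D})$ is the set of functions $x:[0,1]\to\mathbb{D}$ that are right-continuous at every $t\in[0,1)$ and have a left limit $x(t-)\in\mathbb{D}$ at every $t\in(0,1]$, both with respect to $d_{J_1}^0$; convention: $x(0-)=x(0)$. For $x\in\mathbb{D}([0,1];\mathbb{D})$, write $x(t,s)$ for the value of $x(t)\in\mathbb{D}$ at $s$, and $x(t,1-)=\lim_{s\uparrow 1}x(t,s)$. The space is equipped with the metric $d_{\mathbb{D}}(x,y)=\inf_{\lambda\in\Lambda}\{\|\lambda-e\|\vee\rho_{\mathbb{D}}(x,y\circ\lambda)\}$, where $\rho_{\mathbb{D}}(x,y)=\sup_{t\in[0,1]}d_{J_1}^0(x(t),y(t))$, and with its Borel $\sigma$-field. A random element in $\mathbb{D}([0,1];\mathbb{D})$ is a measurable map from a probability space $(\Omega,\mathcal{F},P)$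 into this space; $\stackrel{d}{\to}$ denotes convergence in distribution (weak convergence of laws). For $x\in\mathbb{D}$ and $\delta\in(0,1)$, $w''(x,\delta)=\sup\{|x(s)-x(s_1)|\wedge|x(s_2)-x(s)|:\ s_1\le s\le s_2,\ s_2-s_1\le\delta\}$ (points in $[0,1]$). *)

(* Defs.v *)
From HB Require Import structures.
From mathcomp Require Import all_boot all_order all_algebra.
From mathcomp Require Import all_classical all_reals all_analysis.
From mathcomp Require Import interval_inference lra.

Set Implicit Arguments.
Unset Strict Implicit.
Unset Printing Implicit Defensive.

Import Order.TTheory GRing.Theory Num.Theory.
Import numFieldNormedType.Exports metricType_numDomainType.

Local Open Scope classical_set_scope.
Local Open Scope ring_scope.

Section unit_interval.
Context {R : realType}.
Implicit Types s t u : {i01 R}.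

Let dist s t : R := `|s%:num - t%:num|.

Let distxx s : dist s s = 0. Proof. by rewrite /dist subrr normr0. Qed.

Let dist_positivity s t : dist s t = 0 -> s = t.
Proof. by move/normr0_eq0/eqP; rewrite subr_eq0 => /eqP/val_inj. Qed.

Let distC s t : dist s t = dist t s. Proof. exact: distrC. Qed.

Let dist_triangle t s u : dist s u <= dist s t + dist t u.
Proof. exact: ler_distD. Qed.

HB.instance Definition _ :=
  isMetric.Build R {i01 R} distxx dist_positivity distC dist_triangle.

Lemma i01_distE s t : mdist s t = `|s%:num - t%:num|. Proof. by []. Qed.

End unit_interval.

Section cadlag_functions.
Context {R : realType}.

(* One-sided neighbourhood filters inside [0,1]; nbhs_gt 1 and nbhs_lt 0 are
   improper. *)
Definition nbhs_gt (t : {i01 R}) : set_system {i01 R} :=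
  within [set s | t < s] (nbhs t).

Definition nbhs_lt (t : {i01 R}) : set_system {i01 R} :=
  within [set s | s < t] (nbhs t).

Definition cadlag (E : topologicalType) (x : {i01 R} -> E) : Prop :=
  (forall t, t < 1%:i01 -> x s @[s --> nbhs_gt t] --> x t) /\
  (forall t, 0%:i01 < t -> exists l : E, x s @[s --> nbhs_lt t] --> l).

Definition left_limit (E : ptopologicalType) (x : {i01 R} -> E) (t : {i01 R}) :
    E :=
  if t == 0%:i01 then x t else lim (x s @[s --> nbhs_lt t]).

Definition Lambda : set ({i01 R} -> {i01 R}) :=
  [set l | [/\ {homo l : s t / s < t}, continuous l & range l = setT]].

(* Suprema and infima are taken in the extended reals: an unbounded set has
   supremum +oo, whereas the real-valued sup would return 0. *)
Definition sup_norm (f : {i01 R} -> R) : \bar R :=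
  ereal_sup (range (fun s => `|f s|%:E)).

Definition slope_norm (l : {i01 R} -> {i01 R}) : \bar R :=
  ereal_sup [set `|ln (((l st.2)%:num - (l st.1)%:num) /
                       (st.2%:num - st.1%:num))|%:E
            | st in [set st : {i01 R} * {i01 R} | st.1 < st.2]].

Definition unif_dist (E : metricType R) (x y : {i01 R} -> E) : \bar R :=
  ereal_sup (range (fun t => (mdist (x t) (y t))%:E)).

End cadlag_functions.

Section time_change_theory.
Context {R : realType}.
Implicit Types (s t u : {i01 R}) (l m : {i01 R} -> {i01 R}).
Local Notation i0 := (0%:i01 : {i01 R}).
Local Notation i1 := (1%:i01 : {i01 R}).

Lemma i01_near t (P : set {i01 R}) :
  nbhs t P <-> exists2 e : R, 0 < e & forall s, `|t%:num - s%:num| < e -> P s.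
Proof.
rewrite -filter_from_mdist_nbhs; split.
  by move=> [e /= e0 te]; exists e => // s; exact: te.
by move=> [e e0 te]; exists e => // s; exact: te.
Qed.

Lemma Lambda_le l s t : Lambda l -> (l s <= l t) = (s <= t).
Proof. by case=> lh _ _; exact: (le_mono lh). Qed.

Lemma Lambda_lt l s t : Lambda l -> (l s < l t) = (s < t).
Proof. by case=> lh _ _; exact: (leW_mono (le_mono lh)). Qed.

Lemma Lambda_surj l t : Lambda l -> exists s, l s = t.
Proof.
case=> _ _ lT; have : range l t by rewrite lT.
by move=> [s _ <-]; exists s.
Qed.

Lemma i01_ge0 t : i0 <= t.
Proof. by change (0 <= t%:num). Qed.

Lemma i01_le1 t : t <= i1.
Proof. by change (t%:num <= 1). Qed.

Lemma Lambda0 l : Lambda l -> l i0 = i0.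
Proof.
move=> Ll; have [s ls] := Lambda_surj i0 Ll.
apply/eqP; rewrite eq_le i01_ge0 andbT -[leRHS]ls (Lambda_le _ _ Ll).
exact: i01_ge0.
Qed.

Lemma Lambda1 l : Lambda l -> l i1 = i1.
Proof.
move=> Ll; have [s ls] := Lambda_surj i1 Ll.
apply/eqP; rewrite eq_le i01_le1/= -[leLHS]ls (Lambda_le _ _ Ll).
exact: i01_le1.
Qed.

Lemma mono_surj_continuous l :
  {mono l : s t / s <= t} -> (forall t, exists s, l s = t) -> continuous l.
Proof.
move=> lm ls t A /i01_near[e e0 eA].
have e20 : 0 < e / 2 by rewrite divr_gt0.
have up : exists2 d : R, 0 < d &
    forall s, s%:num < t%:num + d -> (l s)%:num <= (l t)%:num + e / 2.
  have [le1|gt1] := leP ((l t)%:num + e / 2) 1; last first.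
    exists 1 => // s _.
    have : (l s)%:num <= 1 by exact: (i01_le1 (l s)).
    lra.
  have ge0 : 0 <= (l t)%:num + e / 2 by rewrite addr_ge0// ltW.
  have [u lu] := ls (Itv01 ge0 le1).
  have tu : t < u.
    rewrite -(leW_mono lm) lu; change ((l t)%:num < (l t)%:num + e / 2).
    by rewrite ltrDl.
  exists (u%:num - t%:num); first by rewrite subr_gt0; exact: tu.
  move=> s; rewrite addrC subrK => su.
  have : l s <= l u by rewrite lm; exact: ltW.
  by rewrite lu.
have dn : exists2 d : R, 0 < d &
    forall s, t%:num - d < s%:num -> (l t)%:num - e / 2 <= (l s)%:num.
  have [ge0|lt0] := leP 0 ((l t)%:num - e / 2); last first.
    exists 1 => // s _.
    have : 0 <= (l s)%:num by exact: (i01_ge0 (l s)).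
    lra.
  have le1 : (l t)%:num - e / 2 <= 1.
    have : (l t)%:num <= 1 by exact: (i01_le1 (l t)).
    lra.
  have [u lu] := ls (Itv01 ge0 le1).
  have tu : u < t.
    rewrite -(leW_mono lm) lu; change ((l t)%:num - e / 2 < (l t)%:num).
    by rewrite gtrBl.
  exists (t%:num - u%:num); first by rewrite subr_gt0; exact: tu.
  move=> s; rewrite opprB addrC subrK => su.
  have : l u <= l s by rewrite lm; exact: ltW.
  by rewrite lu.
move: up dn => [d d0 up] [d' d'0 dn].
apply/i01_near; exists (Num.min d d'); first by rewrite lt_min d0.
move=> s; rewrite lt_min => /andP[].
move=> h1 h2.
have {}h1 : `|t%:num - s%:num| < d by [].
have {}h2 : `|t%:num - s%:num| < d' by [].
move: h1 h2; rewrite !ltr_distl => /andP[h1 h1'] /andP[h2 h2'].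
have := up s; have := dn s.
have -> : s%:num < t%:num + d by lra.
have -> : t%:num - d' < s%:num by lra.
move=> /(_ isT) dns /(_ isT) ups.
by apply: eA; rewrite ltr_distl; apply/andP; split; lra.
Qed.


Lemma Lambda_id : Lambda (@id {i01 R}).
Proof.
split=> //; first by move=> t; exact: cvg_id.
by apply/seteqP; split=> // t _; exists t.
Qed.

Lemma Lambda_comp l m : Lambda l -> Lambda m -> Lambda (m \o l).
Proof.
move=> Ll Lm; split.
- by move=> s t st /=; rewrite (Lambda_lt _ _ Lm) (Lambda_lt _ _ Ll).
- case: Ll Lm => _ cl _ [_ cm _] t; apply: continuous_comp; first exact: cl.
  exact: cm.
- apply/seteqP; split=> // t _.
  have [u mu] := Lambda_surj t Lm; have [s ls] := Lambda_surj u Ll.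
  by exists s => //=; rewrite ls.
Qed.

Lemma Lambda_inv l : Lambda l ->
  exists m, [/\ Lambda m, cancel l m & cancel m l].
Proof.
move=> Ll; pose m t := sval (cid (Lambda_surj t Ll)).
have ml : cancel m l by move=> t; rewrite /m; case: cid.
have lmono : {mono l : s t / s <= t} by move=> s t; exact: Lambda_le.
have lm : cancel l m.
  by move=> t; apply: (inc_inj lmono); rewrite ml.
have mmono : {mono m : s t / s <= t} by move=> s t; rewrite -lmono !ml.
exists m; split => //; split.
- by move=> s t; rewrite (leW_mono mmono).
- by apply: mono_surj_continuous => // t; exists (l t).
- by apply/seteqP; split => // t _; exists (l t).
Qed.

Lemma cadlag_bounded (E : metricType R) (x : {i01 R} -> E) : cadlag x ->
  exists M, forall s t, mdist (x s) (x t) <= M.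
Proof.
move=> [xr xl]; have [z z0] : exists z : {i01 R}, z = i0 by exists i0.
have z_le s : z <= s by rewrite z0 i01_ge0.
suff [M xM] : exists M, forall s, mdist (x z) (x s) <= M.
  exists (M + M) => s t; rewrite (le_trans (metric_triangle _ (x z) _))//.
  by rewrite lerD// metric_sym.
pose S := [set r : R | 0 <= r <= 1 /\
  exists M, forall s : {i01 R}, s%:num <= r -> mdist (x z) (x s) <= M].
have S0 : S 0.
  split; first by rewrite lexx ler01.
  exists 0 => s s0; have -> : s = z.
    by apply/eqP; rewrite eq_le z_le andbT z0; exact: s0.
  by rewrite mdistxx.
have supS : has_sup S.
  by split; [exists 0|exists 1 => r [/andP[]]].
have c0 : 0 <= sup S by apply: ub_le_sup => //; case: supS.
have c1 : sup S <= 1 by apply: ge_sup; [exists 0|move=> r [/andP[]]].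
pose c : {i01 R} := Itv01 c0 c1.
have [M1 Mlt] : exists M, forall s, s < c -> mdist (x z) (x s) <= M.
  have [c_gt0|c_le0] := ltP z c; last first.
    exists 0 => s sc; have := lt_le_trans sc c_le0.
    by rewrite ltNge z_le.
  have cz : i0 < c by rewrite -z0.
  have [y /cvgrPdist_lt/(_ _ ltr01)] := xl c cz.
  move=> /i01_near[e e0 cy].
  have [r [r01 [M rM]] er] := sup_adherent e0 supS.
  exists (Num.max M (mdist (x z) y + 1)) => s sc; rewrite le_max.
  have [sr|rs] := leP s%:num r; first by rewrite rM.
  apply/orP; right; rewrite (le_trans (metric_triangle _ y _))// lerD2l ltW//.
  apply: cy => //; rewrite ger0_norm ?subr_ge0; first by rewrite /=; lra.
  exact: ltW sc.
pose M2 := Num.max M1 (mdist (x z) (x c)).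
have Mle s : s <= c -> mdist (x z) (x s) <= M2.
  rewrite le_eqVlt => /orP[/eqP->|/Mlt]; rewrite le_max ?lexx ?orbT//.
  by move=> ->.
have [c_lt1|c_ge1] := ltP c i1; last first.
  by exists M2 => s; apply: Mle; rewrite (le_trans _ c_ge1)// i01_le1.
have /cvgrPdist_lt/(_ _ ltr01) := xr c c_lt1.
move=> /i01_near[e e0 cx].
pose r := Num.min 1 (sup S + e / 2).
have rS : S r.
  split.
    by rewrite ge_min lexx le_min ler01/= andbT addr_ge0// divr_ge0// ltW.
  exists (Num.max M2 (mdist (x z) (x c) + 1)) => s sr; rewrite le_max.
  have [/Mle -> //|cs] := leP s c.
  apply/orP; right; rewrite (le_trans (metric_triangle _ (x c) _))//.
  rewrite lerD2l ltW//; apply: cx => //.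
  move: sr; rewrite le_min => /andP[_ sr].
  rewrite ler0_norm ?subr_le0; first by rewrite /=; lra.
  exact: ltW cs.
have : r <= sup S by apply: ub_le_sup => //; case: supS.
rewrite ge_min => /orP[|]; last lra.
by move=> /(lt_le_trans (c_lt1 : sup S < 1)); rewrite ltxx.
Qed.

Lemma unif_dist_ub (E : metricType R) (x y : {i01 R} -> E) t :
  ((mdist (x t) (y t))%:E <= unif_dist x y)%E.
Proof. by apply: ereal_sup_ubound; exists t. Qed.

Lemma unif_dist_le (E : metricType R) (x y : {i01 R} -> E) (e : \bar R) :
  (forall t, ((mdist (x t) (y t))%:E <= e)%E) -> (unif_dist x y <= e)%E.
Proof. by move=> xye; apply: ge_ereal_sup => _ [t _ <-]; exact: xye. Qed.

End time_change_theory.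

(* The common part of the two Skorohod-type metrics: only the cost N of a time
   change differs. *)
Section time_change_distance.
Context {R : realType}.
Implicit Types (s t u : {i01 R}) (l m : {i01 R} -> {i01 R}).
Local Notation i0 := (0%:i01 : {i01 R}).
Local Notation i1 := (1%:i01 : {i01 R}).

Record time_cost (N : ({i01 R} -> {i01 R}) -> \bar R) : Prop := TimeCost {
  time_cost_ge0 : forall l, (0 <= N l)%E ;
  time_cost_id : N id = 0%E ;
  time_cost_inv : forall l m, Lambda l -> Lambda m -> cancel l m ->
    cancel m l -> (N m <= N l)%E ;
  time_cost_comp : forall l m, Lambda l -> Lambda m ->
    (N (m \o l) <= N m + N l)%E ;
  time_cost_small : forall e : R, 0 < e -> exists2 d : R, 0 < d &
    forall l, Lambda l -> (N l < d%:E)%E ->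
    forall s, `|(l s)%:num - s%:num| < e }.

Definition time_dist (N : ({i01 R} -> {i01 R}) -> \bar R) (E : metricType R)
    (x y : {i01 R} -> E) : \bar R :=
  ereal_inf [set maxe (N l) (unif_dist x (y \o l)) | l in Lambda].

Context (N : ({i01 R} -> {i01 R}) -> \bar R) (NP : time_cost N).
Context (E : metricType R).
Implicit Types x y z : {i01 R} -> E.

Lemma time_dist_lt x y (e : \bar R) : (time_dist N x y < e)%E ->
  exists l, [/\ Lambda l, (N l < e)%E & (unif_dist x (y \o l) < e)%E].
Proof.
move=> /ereal_inf_lt[_ [l Ll <-]]; rewrite gt_max => /andP[Nl xyl].
by exists l.
Qed.

Lemma time_dist_le x y l (e : \bar R) : Lambda l -> (N l <= e)%E ->
  (unif_dist x (y \o l) <= e)%E -> (time_dist N x y <= e)%E.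
Proof.
move=> Ll Nl xyl; apply: ereal_inf_le;
  exists (maxe (N l) (unif_dist x (y \o l))).
  by exists l.
by rewrite ge_max Nl.
Qed.

Lemma time_dist_ge0 x y : (0 <= time_dist N x y)%E.
Proof.
by apply: le_ereal_inf_tmp => _ [l _ <-]; rewrite le_max time_cost_ge0.
Qed.

Lemma time_dist_fin x y : cadlag x -> cadlag y -> time_dist N x y \is a fin_num.
Proof.
move=> /cadlag_bounded[M xM] /cadlag_bounded[M' yM'].
rewrite ge0_fin_numE ?time_dist_ge0//.
have [z _] : exists z : {i01 R}, z = i0 by exists i0.
pose K := M + (mdist (x z) (y z) + M').
have M0 : 0 <= M by apply: le_trans (xM z z); exact: mdist_ge0.
have M'0 : 0 <= M' by apply: le_trans (yM' z z); exact: mdist_ge0.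
have K0 : 0 <= K by rewrite !addr_ge0// mdist_ge0.
apply: (@le_lt_trans _ _ K%:E); last exact: ltry.
apply: (time_dist_le Lambda_id); first by rewrite (time_cost_id NP) lee_fin.
apply: unif_dist_le => t; rewrite lee_fin.
rewrite (le_trans (metric_triangle _ (x z) _))// lerD//.
by rewrite (le_trans (metric_triangle _ (y z) _))// lerD.
Qed.

Lemma time_distxx x : time_dist N x x = 0%E.
Proof.
apply/eqP; rewrite eq_le time_dist_ge0 andbT.
apply: (time_dist_le Lambda_id); first by rewrite (time_cost_id NP).
by apply: unif_dist_le => t; rewrite mdistxx.
Qed.

Lemma time_dist_sym x y : time_dist N x y = time_dist N y x.
Proof.
suff le x' y' : (time_dist N x' y' <= time_dist N y' x')%E.
  by apply/eqP; rewrite eq_le !le.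
apply: le_ereal_inf_tmp => _ [l Ll <-].
have [m [Lm lm ml]] := Lambda_inv Ll.
apply: (time_dist_le Lm).
  by rewrite le_max (time_cost_inv NP Ll Lm).
rewrite le_max; apply/orP; right; apply: unif_dist_le => t /=.
by rewrite metric_sym; have := unif_dist_ub y' (x' \o l) (m t); rewrite /= ml.
Qed.

Lemma time_dist_triangle y x z :
  time_dist N x y \is a fin_num -> time_dist N y z \is a fin_num ->
  (time_dist N x z <= time_dist N x y + time_dist N y z)%E.
Proof.
move=> /fineK; set a := fine _ => xya /fineK; set b := fine _ => yzb.
apply/lee_addgt0Pr => e e0; rewrite -xya -yzb -!EFinD.
have e20 : 0 < e / 2 by rewrite divr_gt0.
have : (time_dist N x y < (a + e / 2)%:E)%E by rewrite -xya lte_fin ltrDl.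
move=> /time_dist_lt[l [Ll Nl xyl]].
have : (time_dist N y z < (b + e / 2)%:E)%E by rewrite -yzb lte_fin ltrDl.
move=> /time_dist_lt[m [Lm Nm yzm]].
have -> : a + b + e = (b + e / 2) + (a + e / 2) by lra.
apply: (time_dist_le (Lambda_comp Ll Lm)).
  by rewrite EFinD (le_trans (time_cost_comp NP Ll Lm))// leeD// ltW.
apply: unif_dist_le => t; rewrite addrC lee_fin.
rewrite (le_trans (metric_triangle _ (y (l t)) _))// lerD//.
  by rewrite -lee_fin (le_trans _ (ltW xyl))//; exact: unif_dist_ub.
rewrite -lee_fin (le_trans _ (ltW yzm))//.
exact: (unif_dist_ub y (z \o m) (l t)).
Qed.

Lemma time_dist_positivity x y : cadlag x -> cadlag y ->
  time_dist N x y = 0%E -> x = y.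
Proof.
move=> [xr _] [yr _] xy0; apply/funext => t; apply: mdist_positivity.
apply/eqP; rewrite eq_le mdist_ge0 andbT; apply/ler_addgt0Pr => e e0.
rewrite add0r.
have [t1|] := ltP t i1; last first.
  move=> t1; have ti : t = i1 by apply/eqP; rewrite eq_le t1 i01_le1.
  have : (time_dist N x y < e%:E)%E by rewrite xy0 lte_fin.
  move=> /time_dist_lt[l [Ll _ xyl]].
  have lt : l t = t by rewrite ti; exact: Lambda1.
  have := le_lt_trans (unif_dist_ub x (y \o l) t) xyl.
  by rewrite /= lt lte_fin => /ltW.
have e30 : 0 < e / 3 by rewrite divr_gt0.
have /cvgrPdist_lt/(_ _ e30)/i01_near[d d0 xd] := xr t t1.
have /cvgrPdist_lt/(_ _ e30)/i01_near[d' d'0 yd] := yr t t1.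
pose r : R := Num.min (1 - t%:num) (Num.min d d') / 2.
have t1' : t%:num < 1 by exact: t1.
have r0 : 0 < r by rewrite divr_gt0// !lt_min d0 d'0 subr_gt0 t1'.
have [rt rd rd'] : [/\ r * 2 <= 1 - t%:num, r * 2 <= d & r * 2 <= d'].
  rewrite /r -mulrA mulVf// mulr1; split; rewrite !ge_min lexx ?orbT//.
have u01 : 0 <= t%:num + r by rewrite addr_ge0// ltW.
have u1 : t%:num + r <= 1 by lra.
pose u : {i01 R} := Itv01 u01 u1.
have [h h0 hN] := time_cost_small NP r0.
have : (time_dist N x y < (Num.min h (e / 3))%:E)%E.
  by rewrite xy0 lte_fin lt_min h0.
move=> /time_dist_lt[l [Ll Nl xyl]].
have lu : `|(l u)%:num - (t%:num + r)| < r.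
  by apply: (hN l Ll _ u); rewrite (lt_le_trans Nl)// lee_fin ge_min lexx.
move: lu; rewrite ltr_distl => /andP[lu1 lu2].
have xu : mdist (x t) (x u) < e / 3.
  apply: xd; last by change (t%:num < t%:num + r); rewrite ltrDl.
  by rewrite /= opprD addNKr normrN gtr0_norm//; lra.
have yu : mdist (y t) (y (l u)) < e / 3.
  apply: yd; first by rewrite ltr_distl; apply/andP; split; lra.
  by change (t%:num < (l u)%:num); lra.
have xyu : mdist (x u) (y (l u)) < e / 3.
  rewrite -lte_fin (le_lt_trans (unif_dist_ub x (y \o l) u))//.
  by rewrite (lt_le_trans xyl)// lee_fin ge_min lexx orbT.
have h1 := metric_triangle (x t) (x u) (y t).
have h2 := metric_triangle (x u) (y (l u)) (y t).
have h3 := metric_sym (y (l u)) (y t).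
lra.
Qed.

End time_change_distance.

Section time_costs.
Context {R : realType}.
Implicit Types (s t u : {i01 R}) (l m : {i01 R} -> {i01 R}).
Local Notation i0 := (0%:i01 : {i01 R}).
Local Notation i1 := (1%:i01 : {i01 R}).

Lemma sup_norm_ub (f : {i01 R} -> R) s : (`|f s|%:E <= sup_norm f)%E.
Proof. by apply: ereal_sup_ubound; exists s. Qed.

Lemma sup_norm_le (f : {i01 R} -> R) (e : \bar R) :
  (forall s, (`|f s|%:E <= e)%E) -> (sup_norm f <= e)%E.
Proof. by move=> fe; apply: ge_ereal_sup => _ [s _ <-]; exact: fe. Qed.

Lemma sup_norm_ge0 (f : {i01 R} -> R) : (0 <= sup_norm f)%E.
Proof. by apply: le_trans (sup_norm_ub f i0); rewrite lee_fin. Qed.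

Lemma uniform_time_cost :
  time_cost (fun l => sup_norm (fun t => (l t)%:num - t%:num)).
Proof.
split.
- by move=> l; exact: sup_norm_ge0.
- apply/eqP; rewrite eq_le sup_norm_ge0 andbT; apply: sup_norm_le => s.
  by rewrite subrr normr0.
- move=> l m _ _ lm ml; apply: sup_norm_le => s.
  rewrite distrC -[X in X%:num - _]ml.
  exact: (sup_norm_ub (fun t => (l t)%:num - t%:num)).
- move=> l m _ _; apply: sup_norm_le => s.
  apply: (@le_trans _ _ (`|(m (l s))%:num - (l s)%:num| +
                         `|(l s)%:num - s%:num|)%:E).
    by rewrite lee_fin; exact: ler_distD.
  rewrite EFinD; apply: leeD.
    exact: (sup_norm_ub (fun t => (m t)%:num - t%:num)).
  exact: (sup_norm_ub (fun t => (l t)%:num - t%:num)).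
- move=> e e0; exists e => // l _ le s; rewrite -lte_fin (le_lt_trans _ le)//.
  exact: (sup_norm_ub (fun t => (l t)%:num - t%:num)).
Qed.

Lemma slope_norm_ub l s t : s < t ->
  (`|ln (((l t)%:num - (l s)%:num) / (t%:num - s%:num))|%:E <= slope_norm l)%E.
Proof. by move=> st; apply: ereal_sup_ubound; exists (s, t). Qed.

Lemma slope_norm_le l (e : \bar R) : (forall s t, s < t ->
  (`|ln (((l t)%:num - (l s)%:num) / (t%:num - s%:num))|%:E <= e)%E) ->
  (slope_norm l <= e)%E.
Proof.
by move=> le; apply: ge_ereal_sup => _ [[s t] /= st <-]; exact: le.
Qed.

Lemma slope_norm_ge0 l : (0 <= slope_norm l)%E.
Proof.
have st : i0 < i1 by exact: ltr01.
by apply: le_trans (slope_norm_ub l st); rewrite lee_fin.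
Qed.

Lemma slope_time_cost : time_cost (@slope_norm R).
Proof.
have pos s t : s < t -> 0 < t%:num - s%:num by rewrite subr_gt0.
split.
- exact: slope_norm_ge0.
- apply/eqP; rewrite eq_le slope_norm_ge0 andbT; apply: slope_norm_le => s t st.
  by rewrite divff ?gt_eqF ?pos// ln1 normr0.
- move=> l m Ll Lm lm ml; apply: slope_norm_le => s t st.
  have mst : m s < m t by rewrite (Lambda_lt _ _ Lm).
  have := slope_norm_ub l mst; rewrite !ml.
  by rewrite -[in X in X -> _]invf_div lnV ?normrN// posrE divr_gt0// pos.
- move=> l m Ll Lm; apply: slope_norm_le => s t st.
  have lst : l s < l t by rewrite (Lambda_lt _ _ Ll).
  have mst : m (l s) < m (l t) by rewrite (Lambda_lt _ _ Lm).
  apply: le_trans (leeD (slope_norm_ub m lst) (slope_norm_ub l st)).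
  rewrite -EFinD lee_fin (le_trans _ (ler_normD _ _))//.
  rewrite -lnM ?posrE ?divr_gt0 ?pos//=.
  by rewrite mulrA divfK// gt_eqF// pos.
- move=> e e0; exists (ln (1 + e)); first by rewrite ln_gt0// ltrDl.
  move=> l Ll le s.
  have [s0|] := ltP i0 s; last first.
    move=> s0; have si : s = i0 by apply/eqP; rewrite eq_le s0 i01_ge0.
    have ls : l s = s by rewrite si; exact: Lambda0.
    by rewrite ls subrr normr0.
  have := le_lt_trans (slope_norm_ub l s0) le.
  have -> : (l i0)%:num = 0 by rewrite (Lambda0 Ll).
  rewrite !subr0 lte_fin => lns.
  have s_gt0 : 0 < s%:num by exact: s0.
  have s_le1 : s%:num <= 1 by exact: (i01_le1 s).
  have ls_gt0 : 0 < (l s)%:num.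
    have : l i0 < l s by rewrite (Lambda_lt _ _ Ll).
    by rewrite (Lambda0 Ll).
  move: lns; rewrite ltr_norml => /andP[ln1 ln2].
  have r0 : 0 < (l s)%:num / s%:num by rewrite divr_gt0.
  have e1 : 0 < 1 + e by lra.
  move: ln2; rewrite ltr_ln ?posrE// ltr_pdivrMr// => ls2.
  move: ln1; rewrite -lnV ?posrE// ltr_ln ?posrE ?invr_gt0// ltr_pdivlMr//.
  rewrite -(ltr_pM2l e1) mulrA divff ?gt_eqF// mul1r => ls1.
  rewrite ltr_distl; apply/andP; split; nra.
Qed.

End time_costs.

Section skorohod_space.
Context (R : realType).

Record Dspace := MkDspace {
  Dspace_fun :> {i01 R} -> R ;
  Dspace_cadlag : cadlag Dspace_fun }.

HB.instance Definition _ := gen_eqMixin Dspace.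
HB.instance Definition _ := gen_choiceMixin Dspace.

Lemma Dspace_eq (x y : Dspace) : (x : {i01 R} -> R) = y -> x = y.
Proof.
case: x y => [f fP] [g gP] /= fg; subst g.
by rewrite (Prop_irrelevance fP gP).
Qed.

Lemma cadlag_cst (E : topologicalType) (a : E) : cadlag (fun _ : {i01 R} => a).
Proof. by split=> [t _|t _]; [|exists a]; exact: cvg_cst. Qed.

HB.instance Definition _ :=
  isPointed.Build Dspace (MkDspace (cadlag_cst (0 : R))).

Definition dJ1_ereal (x y : Dspace) : \bar R :=
  ereal_inf [set maxe (slope_norm l) (sup_norm (fun s => x s - y (l s)))
            | l in Lambda].

Definition dJ1 (x y : Dspace) : R := fine (dJ1_ereal x y).

Lemma dJ1_erealE (x y : Dspace) :
  dJ1_ereal x y = time_dist (@slope_norm R) (x : {i01 R} -> R^o) y.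
Proof.
congr ereal_inf; apply: eq_imagel => l _; congr maxe.
congr ereal_sup; apply: eq_imagel => s _.
by rewrite /= distrC.
Qed.

Let cad (x : Dspace) : cadlag (x : {i01 R} -> R^o).
Proof. exact: Dspace_cadlag. Qed.

Lemma dJ1_fin (x y : Dspace) : dJ1_ereal x y \is a fin_num.
Proof. by rewrite dJ1_erealE; exact: (time_dist_fin slope_time_cost). Qed.

Let dJ1xx x : dJ1 x x = 0.
Proof. by rewrite /dJ1 dJ1_erealE (time_distxx slope_time_cost). Qed.

Let dJ1_positivity x y : dJ1 x y = 0 -> x = y.
Proof.
move=> xy0; apply/Dspace_eq.
apply: (time_dist_positivity slope_time_cost (cad x) (cad y)).
by rewrite -dJ1_erealE -(fineK (dJ1_fin x y)) -/(dJ1 x y) xy0.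
Qed.

Let dJ1C x y : dJ1 x y = dJ1 y x.
Proof. by rewrite /dJ1 !dJ1_erealE (time_dist_sym slope_time_cost). Qed.

Let dJ1_triangle y x z : dJ1 x z <= dJ1 x y + dJ1 y z.
Proof.
rewrite -lee_fin EFinD !fineK ?dJ1_fin// !dJ1_erealE.
by apply: (time_dist_triangle slope_time_cost); rewrite -dJ1_erealE dJ1_fin.
Qed.

HB.instance Definition _ :=
  isMetric.Build R Dspace dJ1xx dJ1_positivity dJ1C dJ1_triangle.

Lemma Dspace_mdistE (x y : Dspace) : mdist x y = dJ1 x y. Proof. by []. Qed.

(* The space D([0,1];D): one-sided limits are taken for the metric dJ1. *)
Record DDspace := MkDDspace {
  DDspace_fun :> {i01 R} -> Dspace ;
  DDspace_cadlag : cadlag DDspace_fun }.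

HB.instance Definition _ := gen_eqMixin DDspace.
HB.instance Definition _ := gen_choiceMixin DDspace.

Lemma DDspace_eq (x y : DDspace) : (x : {i01 R} -> Dspace) = y -> x = y.
Proof.
case: x y => [f fP] [g gP] /= fg; subst g.
by rewrite (Prop_irrelevance fP gP).
Qed.

HB.instance Definition _ :=
  isPointed.Build DDspace (MkDDspace (cadlag_cst (point : Dspace))).

Definition dDD_ereal (x y : DDspace) : \bar R :=
  ereal_inf [set maxe (sup_norm (fun t => (l t)%:num - t%:num))
                      (unif_dist x (y \o l))
            | l in Lambda].

Definition dDD (x y : DDspace) : R := fine (dDD_ereal x y).

Lemma dDD_erealE (x y : DDspace) :
  dDD_ereal x y =
  time_dist (fun l => sup_norm (fun t => (l t)%:num - t%:num))
    (x : {i01 R} -> Dspace) y.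
Proof. by []. Qed.

Lemma dDD_fin (x y : DDspace) : dDD_ereal x y \is a fin_num.
Proof.
rewrite dDD_erealE.
exact: (time_dist_fin uniform_time_cost (DDspace_cadlag x)
                                        (DDspace_cadlag y)).
Qed.

Lemma EFin_dDD (x y : DDspace) : (dDD x y)%:E = dDD_ereal x y.
Proof. exact: (fineK (dDD_fin x y)). Qed.

Let dDDxx x : dDD x x = 0.
Proof.
apply: EFin_inj; rewrite EFin_dDD dDD_erealE.
exact: (time_distxx uniform_time_cost).
Qed.

Let dDD_positivity x y : dDD x y = 0 -> x = y.
Proof.
move=> xy0; apply/DDspace_eq.
apply: (time_dist_positivity uniform_time_cost (DDspace_cadlag x)
                                               (DDspace_cadlag y)).
by rewrite -dDD_erealE -EFin_dDD xy0.
Qed.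

Let dDDC x y : dDD x y = dDD y x.
Proof.
exact: (congr1 fine (time_dist_sym uniform_time_cost
                       (x : {i01 R} -> Dspace) y)).
Qed.

Let fine_leD (a b c : \bar R) : a \is a fin_num -> b \is a fin_num ->
  c \is a fin_num -> (a <= b + c)%E -> fine a <= fine b + fine c.
Proof. by case: a b c => [a| |] [b| |] [c| |]. Qed.

Let dDD_triangle y x z : dDD x z <= dDD x y + dDD y z.
Proof.
exact: (fine_leD (dDD_fin x z) (dDD_fin x y) (dDD_fin y z)
          (time_dist_triangle uniform_time_cost (dDD_fin x y) (dDD_fin y z))).
Qed.

HB.instance Definition _ :=
  isMetric.Build R DDspace dDDxx dDD_positivity dDDC dDD_triangle.

Lemma DDspace_mdistE (x y : DDspace) : mdist x y = dDD x y. Proof. by []. Qed.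

Definition w'' (x : Dspace) (delta : R) : \bar R :=
  ereal_sup [set (Num.min `|x s.1.2 - x s.1.1| `|x s.2 - x s.1.2|)%:E
            | s in [set s : {i01 R} * {i01 R} * {i01 R} |
                    s.1.1 <= s.1.2 <= s.2 /\ s.2%:num - s.1.1%:num <= delta]].

End skorohod_space.

Section convergence_in_distribution.

Definition borelType (E : ptopologicalType) := g_sigma_algebraType (@open E).

HB.instance Definition _ (I : Type) (E : ptopologicalType) :=
  isPointed.Build {ptws I -> E} (fun=> point).

Context (R : realType).

Definition weak_cvg (E : ptopologicalType)
    (mu_ : nat -> set (borelType E) -> \bar R)
    (mu : set (borelType E) -> \bar R) : Prop :=
  forall f : E -> R, continuous f -> bounded_fun f ->
    (\int[mu_ n]_y (f y)%:E)%E @[n --> \oo] --> (\int[mu]_y (f y)%:E)%E.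

Definition cvg_in_distribution (d : measure_display) (T : measurableType d)
    (P : probability T R) (E : ptopologicalType) (Y_ : nat -> T -> E)
    (Y : T -> E) : Prop :=
  weak_cvg (fun n => pushforward P (Y_ n : T -> borelType E))
           (pushforward P (Y : T -> borelType E)).

End convergence_in_distribution.

(* An event of the form [set w | exists t, A (X w t)], with X a random element
   of DDspace and t ranging over [0,1], is an uncountable union and need not
   belong to the sigma-algebra, where the values of P are meaningless. The outer
   probability agrees with P on measurable sets, and with the completion of P on
   the P-completed sigma-algebra. *)
Definition outer_prob (R : realType) (d : measure_display)
    (T : measurableType d) (P : probability T R) (A : set T) : \bar R :=
  (P^*)%mu A.

(* Main.v *)
Require Import Defs.
From HB Require Import structures.
From mathcomp Require Import all_boot all_order all_algebra.
From mathcomp Require Import all_classical all_reals all_analysis.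
From mathcomp Require Import measurable_realfun interval_inference lra.

Set Implicit Arguments.
Unset Strict Implicit.
Unset Printing Implicit Defensive.

Import Order.TTheory GRing.Theory Num.Theory.
Import numFieldNormedType.Exports.

Local Open Scope classical_set_scope.
Local Open Scope ring_scope.

(** A path is compared with a step path.  For a partition
    [t 0 < t 1 < ... < t N] of the unit interval, [step_path] holds the value
    [x (t i)] from time [t i] to time [t i.+1].  It is a continuous function of
    the finite vector of the values [x (t i)], so if all [t i] are continuity
    times of the limit, then convergence of the finite-dimensional laws gives
    convergence in distribution of the step paths of the sequence to the step
    path of the limit.  By [converging_together] it is therefore enough that, for
    a fine partition, a path is close to its step path with probability close to
    one, both for the limit and for all late terms of the sequence.  Lipschitz
    test functions suffice there, because a bounded continuous function is the
    increasing limit of Lipschitz functions ([inf_convolution]).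

    Closeness to the step path follows from a bound on the distances
    [three_dist (x r) (x s) (x t)], the smaller of the distances from [x s] to
    [x r] and to [x t].  If these are at most [e] for all times [r <= s <= t] of
    a window of the partition, then within that window the path stays [4 * e]
    close to its value at the left end up to some time [tau], and [4 * e] close
    to its value at the right end from then on ([window_jump]).  A time change
    that carries each [tau] to the right end of its window turns this into
    uniform closeness of path and step path ([step_path_close]).  A time change
    fixes 1, so in the last window the values at the two ends have to be close,
    which is where left-continuity in probability at 1 is used.

    The probability that some triple of times is bad is estimated by chaining
    along a sequence of partitions that are refined dyadically.  Level [k] has
    [2 ^ k] windows, and the moment bound makes it improbable that the point
    which cuts a window at the next level is far from both ends of that window.
    As [2 * alpha > 1], these probabilities are summable over all levels, even
    for distances that decrease geometrically ([level_event_prob]), and off the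
    exceptional event the distances add up to a small bound for all dyadic
    triples ([dyadic_chaining]), hence for all triples by right-continuity
    ([window_three_dist]).  The limit satisfies the moment bound at its own
    continuity times, up to a constant ([three_point_bound_limit]), so that the
    same estimate covers it.

    Two facts about the path space are needed besides.  Events that involve
    finitely many times are measurable, because [x u \in U] for some [u] in an
    open set of times and an open set [U] is an open condition on [x], and values
    at a fixed time are reached from the right ([random_element_eval]).  The
    continuity times of the limit are dense, since the oscillation of a path over
    the interval from [a] to [b] vanishes when [b] decreases to [a], so that
    nested intervals with small oscillation in probability close in on a
    continuity time ([continuity_times_dense]). *)

(** * Random elements and convergence in distribution *)

Section random_elements.
Context (R : realType) (d : measure_display) (T : measurableType d).
Context (P : probability T R).

Definition random_element (E : ptopologicalType) (Y : T -> E) : Prop :=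
  measurable_fun setT (Y : T -> borelType E).

Lemma random_element_open (E : ptopologicalType) (Y : T -> E) (U : set E) :
  random_element Y -> open U -> measurable (Y @^-1` U).
Proof.
move=> mY oU; rewrite -[_ @^-1` _]setTI.
by apply: mY => //; exact: sub_sigma_algebra.
Qed.

Lemma random_elementP (E : ptopologicalType) (Y : T -> E) :
  (forall U : set E, open U -> measurable (Y @^-1` U)) -> random_element Y.
Proof.
move=> oY; rewrite /random_element.
apply: (@measurability _ _ T (borelType E) setT _ (@open E)) => // _ [U oU <-].
by rewrite setTI; exact: oY.
Qed.

Lemma random_element_comp (E E' : ptopologicalType) (Y : T -> E) (h : E -> E') :
  random_element Y -> continuous h -> random_element (h \o Y).
Proof.
move=> mY /continuousP ch; apply: random_elementP => U oU.
by rewrite comp_preimage; exact: (random_element_open mY (ch _ oU)).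
Qed.

Lemma random_element_fun (E : ptopologicalType) (Y : T -> E) (h : E -> R) :
  random_element Y -> continuous h -> measurable_fun setT (h \o Y).
Proof.
move=> mY /continuousP ch; apply: (measurability _ (RGenOpens.measurableE R)).
move=> _ [_ [a [b ->] <-]]; rewrite setTI comp_preimage.
apply: (random_element_open mY); apply: ch; exact: interval_open.
Qed.

Lemma bounded_fun_bound (U : Type) (f : U -> R) :
  bounded_fun f -> exists2 M : R, 0 < M & forall y, `|f y| <= M.
Proof.
move=> [M [_ fM]]; exists (`|M| + 1); first by rewrite ltr_wpDl.
by move=> y; apply: fM => //; rewrite ltr_pwDr// ler_norm.
Qed.

Lemma bounded_fun_le (U : Type) (f : U -> R) (M : R) :
  (forall y, `|f y| <= M) -> bounded_fun f.
Proof.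
by move=> fM; exists M; split; [exact: num_real|move=> N /ltW + y _; exact: le_trans].
Qed.

Lemma bounded_integrable (f : T -> R) (M : R) : measurable_fun setT f ->
  (forall w, `|f w| <= M) -> P.-integrable setT (EFin \o f).
Proof.
move=> mf fM; apply: measurable_bounded_integrable => //.
  by rewrite (le_lt_trans (probability_le1 _ _))// ltry.
exact: bounded_fun_le fM.
Qed.

(** Convergence in distribution is stated with integrals against image measures;
    they are turned into real-valued integrals over the probability space, where
    the linear and order properties of [Rintegral] apply. *)
Lemma integral_law (E : ptopologicalType) (Y : T -> E) (f : E -> R) :
  random_element Y -> continuous f -> bounded_fun f ->
  (\int[pushforward P (Y : T -> borelType E)]_y (f y)%:E)%E =
  (\int[P]_w f (Y w))%:E.
Proof.
move=> mY cf /bounded_fun_bound[M _ fM].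
have fY : P.-integrable setT (EFin \o (f \o Y)).
  apply: (@bounded_integrable _ M); last by move=> w; exact: fM.
  exact: (random_element_fun mY cf).
rewrite (integral_pushforward mY)//.
  rewrite preimage_setT /Rintegral fineK//.
  exact: (integrable_fin_num measurableT fY).
by apply/measurable_EFinP;
  apply: (@measurability _ _ _ _ _ _ _ (RGenOpens.measurableE R));
  move=> _ [_ [a [b ->] <-]]; rewrite setTI; apply: sub_sigma_algebra;
  move/continuousP : cf; apply; exact: interval_open.
Qed.

Lemma cvg_in_distributionP (E : ptopologicalType) (Y_ : nat -> T -> E)
    (Y : T -> E) :
  (forall n, random_element (Y_ n)) -> random_element Y ->
  cvg_in_distribution P Y_ Y <->
  forall f : E -> R, continuous f -> bounded_fun f ->
    \int[P]_w f (Y_ n w) @[n --> \oo] --> \int[P]_w f (Y w).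
Proof.
move=> mY_ mY; split=> YY f cf bf; have := YY f cf bf.
- rewrite integral_law//; under eq_fun do rewrite integral_law//.
  by move/fine_cvgP => [].
- move=> h; rewrite integral_law//; under eq_fun do rewrite integral_law//.
  by apply: cvg_EFin => //; apply: nearW.
Qed.

End random_elements.

Section indicators_and_ramps.
Context (R : realType) (d : measure_display) (T : measurableType d).
Context (P : probability T R).

(** A continuous function between the indicators of the half-lines that start at
    [b] and at [a]; it replaces the indicator of an event under weak limits. *)
Definition ramp (a b v : R) : R := Num.min 1 (Num.max 0 ((v - a) / (b - a))).

Lemma ramp_continuous a b : continuous (ramp a b).
Proof.
apply: (@min_fun_continuous _ _ R); first by move=> v; exact: cvg_cst.
apply: (@max_fun_continuous _ _ R); first by move=> v; exact: cvg_cst.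
by move=> v; apply: cvgM; [apply: cvgB; [exact: cvg_id|exact: cvg_cst]|exact: cvg_cst].
Qed.

Lemma ramp_ge0 a b v : 0 <= ramp a b v.
Proof. by rewrite le_min ler01 le_max lexx. Qed.

Lemma ramp_le1 a b v : ramp a b v <= 1.
Proof. by rewrite ge_min lexx. Qed.

Lemma ramp_bounded a b v : `|ramp a b v| <= 1.
Proof. by rewrite ger0_norm ?ramp_ge0 ?ramp_le1. Qed.

Lemma ramp1 a b v : a < b -> b <= v -> ramp a b v = 1.
Proof.
move=> ab bv; apply/eqP; rewrite eq_le ramp_le1/= le_min lexx/= le_max.
by rewrite ler_pdivlMr ?subr_gt0// mul1r lerB// orbT.
Qed.

Lemma ramp0 a b v : a < b -> v < a -> ramp a b v = 0.
Proof.
move=> ab va; apply/eqP; rewrite eq_le ramp_ge0 andbT ge_min ge_max lexx/=.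
by rewrite mulr_le0_ge0 ?orbT ?invr_ge0 ?subr_ge0 ?subr_le0// ltW.
Qed.

Lemma integrable_indic (A : set T) :
  measurable A -> P.-integrable setT (EFin \o (\1_A : T -> R)).
Proof.
move=> mA; apply: (@bounded_integrable _ _ _ _ _ 1).
  exact: measurable_indic.
by move=> w; rewrite indicE; case: (_ \in _); rewrite ?normr1 ?normr0.
Qed.

Lemma Rintegral_indic (A : set T) :
  measurable A -> \int[P]_w (\1_A w : R) = fine (P A).
Proof. by move=> mA; rewrite /Rintegral integral_indic// setIT. Qed.

End indicators_and_ramps.

Section tail_limits.
Context (R : realType) (d : measure_display) (T : measurableType d).
Context (P : probability T R).

Lemma probability_fin (A : set T) : measurable A -> P A = (fine (P A))%:E.
Proof.
move=> mA; rewrite fineK// ge0_fin_numE//.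
by rewrite (le_lt_trans (probability_le1 P mA))// ltry.
Qed.

Context (E : ptopologicalType) (h : E -> R) (a b : R).
Hypothesis (ch : continuous h).

Let cr : continuous (ramp a b \o h).
Proof. by move=> y; apply: continuous_comp; [exact: ch|exact: ramp_continuous]. Qed.

Lemma measurable_ge c (Y : T -> E) :
  random_element Y -> measurable [set w | c <= h (Y w)].
Proof.
move=> mY; have := random_element_fun mY ch => /(_ measurableT `[c, +oo[%classic).
rewrite setTI => /(_ (measurable_itv _)); congr measurable.
by apply/seteqP; split=> w /=; rewrite in_itv/= andbT.
Qed.

Let int_ramp (Y : T -> E) : random_element Y ->
  P.-integrable setT (EFin \o (fun w => ramp a b (h (Y w)))).
Proof.
move=> mY; apply: (@bounded_integrable _ _ _ _ _ 1); last first.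
  by move=> w; exact: ramp_bounded.
exact: (random_element_fun mY cr).
Qed.

Hypothesis (ab : a < b).

Lemma ramp_integral_le (Y : T -> E) : random_element Y ->
  \int[P]_w ramp a b (h (Y w)) <= fine (P [set w | a <= h (Y w)]).
Proof.
move=> mY; rewrite -Rintegral_indic; last exact: measurable_ge.
apply: le_Rintegral => //; first exact: int_ramp.
  by apply: integrable_indic; exact: measurable_ge.
move=> w _; rewrite indicE; have [ah|ha] := leP a (h (Y w)).
  by rewrite mem_set//; exact: ramp_le1.
by rewrite ramp0.
Qed.

Lemma ramp_integral_ge (Y : T -> E) : random_element Y ->
  fine (P [set w | b <= h (Y w)]) <= \int[P]_w ramp a b (h (Y w)).
Proof.
move=> mY; rewrite -Rintegral_indic; last exact: measurable_ge.
apply: le_Rintegral => //; last first.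
- move=> w _; rewrite indicE; case: (boolP (w \in _)); last by rewrite ramp_ge0.
  by move/set_mem => /= bh; rewrite ramp1.
- exact: int_ramp.
- by apply: integrable_indic; exact: measurable_ge.
Qed.

Context (Y_ : nat -> T -> E) (Y : T -> E).
Hypotheses (mY_ : forall n, random_element (Y_ n)) (mY : random_element Y).
Hypothesis (YY : cvg_in_distribution P Y_ Y).

Let cvg_ramp :
  \int[P]_w ramp a b (h (Y_ n w)) @[n --> \oo] --> \int[P]_w ramp a b (h (Y w)).
Proof.
move/(cvg_in_distributionP P mY_ mY) : YY => /(_ _ cr); apply.
by apply: (@bounded_fun_le _ _ _ 1) => y; exact: ramp_bounded.
Qed.

(** The two thresholds [a < b] make the statement true with non-strict events on
    both sides and without any condition on the law of the limit. *)
Lemma tail_limit_le (B : R) :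
  (\forall n \near \oo, (P [set w | (a <= h (Y_ n w))%R] <= B%:E)%E) ->
  (P [set w | (b <= h (Y w))%R] <= B%:E)%E.
Proof.
move=> PB; rewrite probability_fin; last exact: measurable_ge.
rewrite lee_fin (le_trans (ramp_integral_ge mY))//.
apply: (cvgr_to_le cvg_ramp); move: PB; apply: filterS => n PB.
rewrite (le_trans (ramp_integral_le (mY_ n)))// -lee_fin -probability_fin//.
exact: measurable_ge.
Qed.

Lemma tail_limit_lt (B : R) : (P [set w | (a <= h (Y w))%R] < B%:E)%E ->
  \forall n \near \oo, (P [set w | (b <= h (Y_ n w))%R] < B%:E)%E.
Proof.
rewrite probability_fin; last exact: measurable_ge.
rewrite lte_fin => /(le_lt_trans (ramp_integral_le mY)) PB.
have := cvg_ramp; move=> /cvgr_lt/(_ _ PB); apply: filterS => n nB.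
rewrite probability_fin; last exact: measurable_ge.
by rewrite lte_fin (le_lt_trans (ramp_integral_ge (mY_ n))).
Qed.

End tail_limits.

Section null_liminf.
Context (R : realType) (d : measure_display) (T : measurableType d).
Context (P : probability T R).

(** A version of the Borel-Cantelli lemma in which the probabilities need not be
    summable, because [w] is required to lie in all late [A m]. *)
Lemma liminf_null (A : nat -> set T) : (forall m, measurable (A m)) ->
  P (A m) @[m --> \oo] --> 0%E ->
  P.-negligible [set w | \forall m \near \oo, A m w].
Proof.
move=> mA PA; pose B k := \bigcap_(m in [set m | (k <= m)%N]) A m.
have mB k : measurable (B k) by apply: bigcap_measurable => //; exists k => /=.
have B0 k : P (B k) = 0%E.
  apply/eqP; rewrite eq_le measure_ge0 andbT.
  apply: (cvge_to_ge PA).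
  exists k => // m /= km; apply: le_measure; rewrite ?inE//.
  exact: bigcap_inf.
suff : P.-negligible (\bigcup_k B k).
  by apply: negligibleS => w [k _ kA]; exists k.
apply: negligible_bigcup => k; by exists (B k); split; [exact: mB|exact: B0|].
Qed.

End null_liminf.

(** * Lipschitz test functions and converging together *)

Lemma nbhs_metricP (R : realType) (E : metricType R) (y : E) (A : set E) :
  nbhs y A <-> exists2 e : R, 0 < e & forall z, mdist y z < e -> A z.
Proof.
rewrite -metricType_numDomainType.filter_from_mdist_nbhs.
by split=> -[e e0 eA]; exists e.
Qed.

Section lipschitz_minorant.
Context (R : realType) (E : metricType R) (f : E -> R) (M : R).
Hypothesis fM : forall y, `|f y| <= M.

(** The largest [k]-Lipschitz minorant of [f]. *)
Definition inf_convolution (k : R) (y : E) : R :=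
  inf (range (fun z => f z + k * mdist y z)).

Let lb k y : 0 <= k -> lbound (range (fun z => f z + k * mdist y z)) (- M).
Proof.
move=> k0 _ [z _ <-]; have := fM z; rewrite ler_norml => /andP[fz _].
by rewrite (le_trans fz)// lerDl mulr_ge0// mdist_ge0.
Qed.

Let hi k y : 0 <= k -> has_inf (range (fun z => f z + k * mdist y z)).
Proof.
move=> k0; split; first by exists (f y + k * mdist y y); exists y.
by exists (- M); exact: lb.
Qed.

Lemma inf_convolution_le_at k y z : 0 <= k ->
  inf_convolution k y <= f z + k * mdist y z.
Proof. by move=> k0; apply: ge_inf; [exact: (hi y k0).2|exists z]. Qed.

Lemma inf_convolution_le k y : 0 <= k -> inf_convolution k y <= f y.
Proof.
move=> k0; have := inf_convolution_le_at y y k0.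
by rewrite mdistxx mulr0 addr0.
Qed.

Lemma inf_convolution_ge k y (c : R) :
  (forall z, c <= f z + k * mdist y z) -> c <= inf_convolution k y.
Proof.
move=> ck; apply: lb_le_inf; first by exists (f y + k * mdist y y); exists y.
by move=> _ [z _ <-]; exact: ck.
Qed.

Lemma inf_convolution_norm k y : 0 <= k -> `|inf_convolution k y| <= M.
Proof.
move=> k0; rewrite ler_norml; apply/andP; split.
  by apply: inf_convolution_ge => z; apply: (lb k0); exists z.
rewrite (le_trans (inf_convolution_le y k0))//.
by rewrite (le_trans (ler_norm _)).
Qed.

Lemma inf_convolution_lipschitz k y z : 0 <= k ->
  `|inf_convolution k y - inf_convolution k z| <= k * mdist y z.
Proof.
move=> k0; wlog suff le : y z / inf_convolution k y <= inf_convolution k z + k * mdist y z.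
  have := le y z; have := le z y; rewrite (metric_sym z y) => h1 h2.
  by rewrite ler_norml; apply/andP; split; lra.
rewrite -lerBlDr; apply: inf_convolution_ge => u.
rewrite lerBlDr (le_trans (inf_convolution_le_at y u k0))//.
rewrite -addrA lerD2l -mulrDr ler_wpM2l// addrC.
exact: metric_triangle.
Qed.

(** Points [z] at a fixed distance from [y] are penalised more than the range of
    [f] for large [m]; at the other points continuity of [f] applies. *)
Lemma inf_convolution_cvg y : {for y, continuous f} ->
  inf_convolution m%:R y @[m --> \oo] --> f y.
Proof.
move=> cf; apply/cvgrPdist_le => e e0.
have /cvgrPdist_lt/(_ _ e0)/nbhs_metricP[r r0 fr] := cf.
near=> m.
have m0 : 0 <= m%:R :> R by [].
rewrite ger0_norm ?subr_ge0 ?inf_convolution_le// lerBlDr -lerBlDl.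
apply: inf_convolution_ge => z; have [yz|ry] := ltP (mdist y z) r.
  have := fr _ yz; rewrite /= ltr_norml => /andP[_ fz].
  by rewrite (@le_trans _ _ (f z))// ?lerDl ?mulr_ge0 ?mdist_ge0//; lra.
have mM : 2 * M <= m%:R * mdist y z.
  rewrite (@le_trans _ _ (m%:R * r))// ?ler_wpM2l// -ler_pdivrMr//.
  by near: m; exact: nbhs_infty_ger.
have := fM y; have := fM z; rewrite !ler_norml => /andP[fz _] /andP[_ fy].
lra.
Unshelve. all: by end_near. Qed.

End lipschitz_minorant.

Lemma lipschitz_continuous (R : realType) (E : metricType R) (f : E -> R) (k : R) :
  (forall y z, `|f y - f z| <= k * mdist y z) -> continuous f.
Proof.
move=> fk y; apply/cvgrPdist_lt => e e0; apply/nbhs_metricP.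
have k0 : 0 < `|k| + 1 by rewrite ltr_wpDl.
exists (e / (`|k| + 1)); first by rewrite divr_gt0.
move=> z yz; rewrite /= (le_lt_trans (fk y z))//.
rewrite (@le_lt_trans _ _ ((`|k| + 1) * mdist y z))//.
  by rewrite ler_wpM2r ?mdist_ge0// ler_wpDr// ler_norm.
by rewrite mulrC -ltr_pdivlMr.
Qed.

Section converging_together.
Context (R : realType) (d : measure_display) (T : measurableType d).
Context (P : probability T R).
Local Notation E := (DDspace R).
Context (Y_ : nat -> T -> E) (Y : T -> E).
Hypotheses (mY_ : forall n, random_element (Y_ n)) (mY : random_element Y).

Lemma Rintegral_bounded_fun (Z : T -> E) (f : E -> R) (M : R) :
  random_element Z -> continuous f -> (forall y, `|f y| <= M) ->
  P.-integrable setT (EFin \o (fun w => f (Z w))).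
Proof.
move=> mZ cf fM; apply: (@bounded_integrable _ _ _ _ _ M) => [|w //].
exact: (random_element_fun mZ cf).
Qed.

Let arith (a b c c' e : R) : a - e / 2 < b -> b - e / 2 < c -> c <= c' ->
  a - e < c'.
Proof. lra. Qed.

(** Approximation of [f] from below by Lipschitz functions bounds the lower limit
    of the integrals; the same for [- f] bounds the upper limit. *)
Lemma lipschitz_cvg_in_distribution :
  (forall (f : E -> R) (M k : R), (forall y, `|f y| <= M) ->
     (forall y z, `|f y - f z| <= k * mdist y z) ->
     \int[P]_w f (Y_ n w) @[n --> \oo] --> \int[P]_w f (Y w)) ->
  cvg_in_distribution P Y_ Y.
Proof.
move=> YY; apply/cvg_in_distributionP => // f cf /bounded_fun_bound[M _ fM].
have low (g : E -> R) (e : R) : continuous g -> (forall y, `|g y| <= M) -> 0 < e ->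
    \forall n \near \oo, \int[P]_w g (Y w) - e < \int[P]_w g (Y_ n w).
  move=> cg gM e0; have e20 : 0 < e / 2 by rewrite divr_gt0.
  pose gk m := inf_convolution g m%:R.
  have gkL m y z : `|gk m y - gk m z| <= m%:R * mdist y z.
    exact: (inf_convolution_lipschitz gM).
  have gkM m y : `|gk m y| <= M by exact: (inf_convolution_norm gM).
  have gkc m : continuous (gk m) := lipschitz_continuous (gkL m).
  have : \int[P]_w gk m (Y w) @[m --> \oo] --> \int[P]_w g (Y w).
    have [//|||||_ _] := @dominated_convergence _ _ _ P setT measurableT
      (fun m w => (gk m (Y w))%:E) (fun w => (g (Y w))%:E) (cst M%:E).
    - move=> m; apply/measurable_EFinP.
      exact: (random_element_fun mY (gkc m)).
    - apply/measurable_EFinP; exact: (random_element_fun mY cg).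
    - apply: aeW => w _; apply: cvg_EFin; first exact: nearW.
      exact: (inf_convolution_cvg gM (cg (Y w))).
    - exact: (@bounded_integrable _ _ _ P (cst M) `|M|).
    - by apply: aeW => w m _ /=; rewrite lee_fin.
    rewrite -[X in _ --> X](fineK (integrable_fin_num measurableT
      (Rintegral_bounded_fun mY cg gM))) => /fine_cvgP[_]; exact.
  move=> /cvgr_gt/(_ (\int[P]_w g (Y w) - e / 2)).
  rewrite gtrBl => /(_ e20)[m _ /(_ m (leqnn m))] gm.
  have lt_gk : \int[P]_w gk m (Y w) - e / 2 < \int[P]_w gk m (Y w).
    by rewrite gtrBl.
  have := YY _ _ _ (gkM m) (gkL m).
  move=> /cvgr_gt/(_ _ lt_gk) near_gk.
  apply: filterS near_gk => n gn.
  have : \int[P]_w gk m (Y_ n w) <= \int[P]_w g (Y_ n w).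
    apply: le_Rintegral => //; [exact: Rintegral_bounded_fun|
      exact: Rintegral_bounded_fun|].
    by move=> w _; exact: (inf_convolution_le gM).
  exact: arith gm gn.
apply/cvgrPdist_lt => e e0.
have fN y : `|- f y| <= M by rewrite normrN.
have cN : continuous (fun y => - f y) by move=> y; exact: (cvgN (cf y)).
have intN Z : random_element Z ->
    \int[P]_w (- f (Z w)) = - \int[P]_w f (Z w).
  move=> mZ; rewrite -[RHS]mulN1r -RintegralZl//.
    by under [RHS]eq_Rintegral do rewrite mulN1r.
  exact: Rintegral_bounded_fun.
have := low _ e cN fN e0; rewrite (intN Y mY) => lowN.
apply: filterS2 lowN (low _ e cf fM e0) => n.
rewrite (intN (Y_ n) (mY_ n)) -opprD ltrN2 => hN h.
rewrite ltr_norml; apply/andP; split.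
  by rewrite ltrBrDr addrC ltrBlDr.
by rewrite ltrBlDr addrC -ltrBlDr.
Qed.

Lemma Rintegral_dist_le (Z W : T -> E) (f : E -> R) (M k e q : R) (B : set T) :
  random_element Z -> random_element W -> (forall y, `|f y| <= M) ->
  0 <= k -> (forall y z, `|f y - f z| <= k * mdist y z) ->
  measurable B -> (P B <= q%:E)%E ->
  (forall w, ~ B w -> mdist (Z w) (W w) <= e) ->
  0 <= e ->
  `|\int[P]_w f (Z w) - \int[P]_w f (W w)| <= k * e + 2 * M * q.
Proof.
move=> mZ mW fM k0 fk mB Bq ZWe e0.
have cf : continuous f := lipschitz_continuous fk.
have iZ := Rintegral_bounded_fun mZ cf fM.
have iW := Rintegral_bounded_fun mW cf fM.
have M0 : 0 <= M by apply: le_trans (fM (Z point)).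
have iD : P.-integrable setT (EFin \o (fun w => f (Z w) - f (W w))).
  exact: (integrableB measurableT iZ iW).
rewrite -RintegralB// (le_trans (le_normr_Rintegral _ iD))//.
pose g w : R := k * e + 2 * M * \1_B w.
have iB := integrable_indic P mB.
have igB : P.-integrable setT (EFin \o (fun w => 2 * M * \1_B w)).
  apply: (@bounded_integrable _ _ _ _ _ (2 * M)).
    by apply: measurable_funM => //; exact: measurable_indic.
  move=> w; rewrite indicE; case: (_ \in _); rewrite ?mulr1 ?mulr0 ?normr0.
    by rewrite ger0_norm// mulr_ge0.
  by rewrite mulr_ge0.
have ic : P.-integrable setT (EFin \o (fun _ : T => k * e)).
  exact: (@bounded_integrable _ _ _ P (cst (k * e)) `|k * e|).
apply: (@le_trans _ _ (\int[P]_w g w)).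
  apply: le_Rintegral => //.
  - exact: (integrable_abse iD).
  - exact: (integrableD measurableT ic igB).
  move=> w _; rewrite /g indicE; case: (boolP (w \in B)) => wB.
    rewrite mulr1 (le_trans (ler_normB _ _))// -[leLHS]add0r lerD ?mulr_ge0//.
    by rewrite mulr_natl mulr2n lerD.
  rewrite mulr0 addr0 (le_trans (fk _ _))// ler_wpM2l//.
  by apply: ZWe; move/mem_set; exact/negP.
rewrite RintegralD// Rintegral_cst//.
rewrite (_ : fine _ = 1) ?mulr1 ?lerD2l; last first.
  exact: (congr1 fine (probability_setT P)).
by rewrite RintegralZl// Rintegral_indic// ler_wpM2l ?mulr_ge0// -lee_fin -probability_fin.
Qed.

(** If the approximations converge in distribution for each quality [e] of
    approximation, then so does the sequence; the approximations may depend on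
    [e] in any way. *)
Lemma converging_together :
  (forall e : R, 0 < e -> exists (Z_ : nat -> T -> E) (Z : T -> E),
    [/\ forall n, random_element (Z_ n), random_element Z,
        cvg_in_distribution P Z_ Z,
        \forall n \near \oo, exists B, [/\ measurable B, (P B <= e%:E)%E &
          forall w, ~ B w -> mdist (Y_ n w) (Z_ n w) <= e] &
        exists B, [/\ measurable B, (P B <= e%:E)%E &
          forall w, ~ B w -> mdist (Y w) (Z w) <= e]]) ->
  cvg_in_distribution P Y_ Y.
Proof.
move=> approx; apply: lipschitz_cvg_in_distribution => f M k fM fk.
have M0 : 0 <= M by apply: le_trans (fM point).
have fk' y z : `|f y - f z| <= `|k| * mdist y z.
  by rewrite (le_trans (fk y z))// ler_wpM2r ?mdist_ge0// ler_norm.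
have cf : continuous f := lipschitz_continuous fk.
apply/cvgrPdist_lt => e e0.
(* The summand 1 only serves to make the constant positive. *)
pose c := `|k| + 2 * M + 1.
have c0 : 0 < c by rewrite ltr_wpDl// addr_ge0// mulr_ge0.
pose q := e / (4 * c).
have q0 : 0 < q by rewrite divr_gt0// mulr_gt0.
have qc : `|k| * q + 2 * M * q <= e / 4.
  have -> : q = e / 4 / c by rewrite /q invfM mulrA.
  rewrite -mulrDl mulrA ler_pdivrMr// mulrC ler_wpM2l ?divr_ge0 ?ltW//.
  by rewrite ltrDl.
have [Z_ [Z [mZ_ mZ ZZ near_ [B [mB PB YZ]]]]] := approx q q0.
move/(cvg_in_distributionP P mZ_ mZ) : ZZ => /(_ f cf (bounded_fun_le fM)).
have e40 : 0 < e / 4 by rewrite divr_gt0.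
move=> /cvgrPdist_lt/(_ _ e40) ZZ.
near=> n.
have h1 : `|\int[P]_w f (Y w) - \int[P]_w f (Z w)| <= e / 4.
  by rewrite (le_trans _ qc)//; apply: (Rintegral_dist_le (B := B)) => //; exact: ltW.
have h2 : `|\int[P]_w f (Y_ n w) - \int[P]_w f (Z_ n w)| <= e / 4.
  have [B' [mB' PB' YZ']] : exists B, [/\ measurable B, (P B <= q%:E)%E &
          forall w, ~ B w -> mdist (Y_ n w) (Z_ n w) <= q] by near: n.
  by rewrite (le_trans _ qc)//; apply: (Rintegral_dist_le (B := B')) => //; exact: ltW.
have h3 : `|\int[P]_w f (Z w) - \int[P]_w f (Z_ n w)| < e / 4 by near: n.
move: h1 h2 h3; move: (\int[P]_w f (Y w)) (\int[P]_w f (Y_ n w))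
  (\int[P]_w f (Z w)) (\int[P]_w f (Z_ n w)) => a b a' b'.
rewrite !ler_norml !ltr_norml => /andP[? ?] /andP[? ?] /andP[? ?].
by apply/andP; split; lra.
Unshelve. all: by end_near. Qed.

End converging_together.

(** * Evaluation at finitely many times *)

Section finite_product.
Context (R : realType) (E : metricType R) (k : nat).
Local Notation Ek := {ptws 'I_k -> E}.

(** The product topology of finitely many copies of a metric space is that of the
    maximum metric. *)
Lemma nbhs_boxP (y : Ek) (A : set Ek) :
  nbhs y A <-> exists2 e : R, 0 < e &
    forall z : 'I_k -> E, (forall i, mdist (y i) (z i) < e) -> A z.
Proof.
pose box (e : R) : set Ek := [set z : Ek | forall i, mdist (y i) (z i) < e].
pose G := filter_from [set e : R | 0 < e] box.
have FG : Filter G.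
  apply: filter_from_filter; first by exists 1 => /=.
  move=> e f e0 f0; exists (Num.min e f); first by rewrite /= lt_min e0.
  by move=> z zef; split=> i; have := zef i; rewrite lt_min => /andP[].
split=> [yA|[e e0 eA]].
  have Gy : G --> y.
    apply/cvg_sup => i U [V] [[W] oW <-] Wy WU.
    have /nbhs_metricP[e e0 eW] : nbhs (y i) W by exact: open_nbhs_nbhs.
    by exists e => // z /(_ i) ze; apply: WU; exact: eW.
  by have [e e0 eA] := Gy _ yA; exists e => // z; exact: eA.
have : \forall z \near y, forall i, mdist (y i) ((z : Ek) i) < e.
  apply: (@filter_forall Ek 'I_k (fun i z => mdist (y i) (z i) < e) (nbhs y) (nbhs_filter y)) => i.
  have /(_ [set v | mdist (y i) v < e]) := @proj_continuous _ (fun=> E) i y.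
  by apply; apply/nbhs_metricP; exists e.
by apply: filterS => z; exact: eA.
Qed.

Lemma box_continuous (T : topologicalType) (h : Ek -> T) :
  (forall (y : Ek) (U : set T), nbhs (h y) U -> exists2 e : R, 0 < e &
    forall z : 'I_k -> E, (forall i, mdist (y i) (z i) < e) -> U (h z)) ->
  continuous h.
Proof. by move=> hU y U /hU; rewrite -nbhs_boxP. Qed.

End finite_product.

Section DD_neighbourhoods.
Context (R : realType).
Local Notation i0 := (0%:i01 : {i01 R}).
Local Notation i1 := (1%:i01 : {i01 R}).
Implicit Types (s t u : {i01 R}) (x y : DDspace R).

Lemma dDD_lt x y (e : R) : mdist x y < e -> exists l : {i01 R} -> {i01 R},
  [/\ Lambda l, forall s, `|(l s)%:num - s%:num| < e &
    forall t, mdist (x t) (y (l t)) < e].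
Proof.
rewrite -lte_fin EFin_dDD dDD_erealE => /time_dist_lt[l [Ll le xyl]].
exists l; split=> // [s|t]; rewrite -lte_fin.
  apply: le_lt_trans le.
  exact: (sup_norm_ub (fun t => (l t)%:num - t%:num)).
exact: le_lt_trans (unif_dist_ub x (y \o l) t) xyl.
Qed.

Lemma dDD_le x y (l : {i01 R} -> {i01 R}) (e : R) : Lambda l ->
  (forall s, `|(l s)%:num - s%:num| <= e) ->
  (forall t, mdist (x t) (y (l t)) <= e) -> mdist x y <= e.
Proof.
move=> Ll le xyl; rewrite -lee_fin EFin_dDD dDD_erealE.
apply: (time_dist_le Ll); first by apply: sup_norm_le => s; rewrite lee_fin.
by apply: unif_dist_le => t; rewrite lee_fin.
Qed.

(** A class of sets of times that contains the open intervals and also the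
    singleton of the end point 1, which every time change fixes. *)
Definition time_stable (N : set {i01 R}) := forall t, N t ->
  exists2 e : R, 0 < e & forall l, Lambda l ->
    (forall s, `|(l s)%:num - s%:num| < e) -> N (l t).

Lemma time_stable_itv (a b : R) : time_stable [set t | a < t%:num < b].
Proof.
move=> t /= /andP[at_ tb]; exists (Num.min (t%:num - a) (b - t%:num)).
  by rewrite lt_min !subr_gt0 at_.
move=> l Ll /(_ t); rewrite lt_min !ltr_norml => /andP[/andP[h1 h2] /andP[h3 h4]].
by apply/andP; split; lra.
Qed.

Lemma time_stable1 : time_stable [set i1].
Proof. by move=> _ ->; exists 1 => // l Ll _; rewrite /= Lambda1. Qed.

(** A path close to [x] passes, at slightly moved times, through values close to
    those of [x].  With a fixed interior time in place of a set [N i] this would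
    fail, as evaluation at such a time is not continuous. *)
Lemma open_ex_times k (N : 'I_k -> set {i01 R})
    (U : set {ptws 'I_k -> Dspace R}) :
  (forall i, time_stable (N i)) -> open U ->
  open [set x : DDspace R | exists u : 'I_k -> {i01 R},
    (forall i, N i (u i)) /\ U (fun i => x (u i))].
Proof.
move=> sN oU; rewrite openE => x [u [Nu Uu]].
have /nbhs_boxP[e e0 eU] : nbhs ((fun i => x (u i)) : {ptws 'I_k -> Dspace R}) U.
  exact: open_nbhs_nbhs.
have : \forall h \near 0^'+, forall i, forall l : {i01 R} -> {i01 R}, Lambda l ->
    (forall s, `|(l s)%:num - s%:num| < h) -> N i (l (u i)).
  apply: filter_forall => i; have [f f0 fN] := sN i _ (Nu i).
  near=> h => l Ll lh; apply: fN => // s; apply: lt_trans (lh s) _.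
  by near: h; exact: nbhs_right_lt.
move=> hN; have [h [h0 he hN']] : exists h : R, [/\ 0 < h, h < e & 
    forall i, forall l : {i01 R} -> {i01 R}, Lambda l ->
    (forall s, `|(l s)%:num - s%:num| < h) -> N i (l (u i))].
  near (0 : R)^'+ => h; exists h; split; near: h.
  - exact: nbhs_right_gt.
  - exact: nbhs_right_lt.
  - exact: hN.
apply/nbhs_metricP; exists h => // y /dDD_lt[l [Ll lh xyl]].
exists (l \o u); split=> [i|]; first exact: hN'.
by apply: eU => i; exact: lt_trans (xyl _) he.
Unshelve. all: by end_near. Qed.

(** Points immediately to the right of [t]; at the right end point, where there
    are none, [1] itself. *)
Definition right_nbhd (j : nat) t : set {i01 R} :=
  if t == i1 then [set i1]
  else [set s | t%:num < s%:num < t%:num + j.+1%:R^-1].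

Lemma right_nbhd_stable j t : time_stable (right_nbhd j t).
Proof.
by rewrite /right_nbhd; case: ifP => _; [exact: time_stable1|exact: time_stable_itv].
Qed.

Lemma right_nbhd_ex j t : exists s, right_nbhd j t s.
Proof.
rewrite /right_nbhd; case: ifPn => [_|t1]; first by exists i1.
have {}t1 : t%:num < 1.
  have : t <= i1 by exact: i01_le1.
  by rewrite le_eqVlt (negbTE t1).
have j0 : 0 < j.+1%:R^-1 :> R by rewrite invr_gt0.
pose r : R := Num.min (1 - t%:num) j.+1%:R^-1 / 2.
have r0 : 0 < r by rewrite divr_gt0// lt_min subr_gt0 t1.
have rt : r * 2 <= 1 - t%:num by rewrite divfK// ge_min lexx.
have rj : r * 2 <= j.+1%:R^-1 by rewrite divfK// ge_min lexx orbT.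
have t0 : 0 <= t%:num by exact: (i01_ge0 t).
have u0 : 0 <= t%:num + r by lra.
have u1 : t%:num + r <= 1 by lra.
exists (Itv01 u0 u1); change (t%:num < t%:num + r < t%:num + j.+1%:R^-1).
by rewrite ltrDl r0 ltrD2l/= (lt_le_trans _ rj)// ltr_pMr// ltr1n.
Qed.

Lemma cadlag_right (E : metricType R) (x : {i01 R} -> E) t (e : R) : cadlag x ->
  0 < e -> exists2 h : R, 0 < h &
    forall s, t%:num <= s%:num < t%:num + h -> mdist (x t) (x s) < e.
Proof.
move=> [xr _] e0; have [t1|t1] := ltP t i1; last first.
  exists 1 => // s /andP[ts _].
  have -> : s = t by apply/le_anti/andP; split=> //; exact: le_trans (i01_le1 s) t1.
  by rewrite mdistxx.
move: t1 => /xr /(_ [set y | mdist (x t) y < e]) h.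
have /h : nbhs (x t) [set y | mdist (x t) y < e] by apply/nbhs_metricP; exists e.
move=> /i01_near[f f0 fx]; exists f => // s /andP[ts st].
move: ts; rewrite le_eqVlt => /predU1P[/val_inj <-|ts]; first by rewrite mdistxx.
apply: fx => //; rewrite ltr_norml; apply/andP; split; lra.
Qed.

Lemma cadlag_left (E : metricType R) (x : {i01 R} -> E) t : cadlag x ->
  i0 < t -> exists l : E, forall e : R, 0 < e -> exists2 h : R, 0 < h &
    forall s, t%:num - h < s%:num < t%:num -> mdist l (x s) < e.
Proof.
move=> [_ xl] /xl[l ll]; exists l => e e0.
have /ll : nbhs l [set y | mdist l y < e] by apply/nbhs_metricP; exists e.
move=> /i01_near[f f0 fx]; exists f => // s /andP[ts st].
apply: fx => //; rewrite ltr_norml; apply/andP; split; lra.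
Qed.

Lemma right_nbhd_near (E : metricType R) (x : {i01 R} -> E) t (e : R) :
  cadlag x -> 0 < e -> \forall j \near \oo,
    forall s, right_nbhd j t s -> mdist (x t) (x s) < e.
Proof.
move=> cx e0; rewrite /right_nbhd; have [->|t1] := eqVneq t i1.
  by apply: nearW => j s ->; rewrite mdistxx.
have [h h0 xh] := cadlag_right t cx e0.
near=> j => s /= /andP[ts sj]; apply: xh; rewrite ltW//= (lt_trans sj)//.
by rewrite ltrD2l; near: j; exact: (near_infty_natSinv_lt (PosNum h0)).
Unshelve. all: by end_near. Qed.

End DD_neighbourhoods.

Section evaluation.
Context (R : realType) (d : measure_display) (T : measurableType d).
Context (Y : T -> DDspace R).
Hypothesis mY : random_element Y.
Local Notation i0 := (0%:i01 : {i01 R}).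
Local Notation i1 := (1%:i01 : {i01 R}).

(** Evaluation at the times [t i] is measurable although it is not continuous:
    the values at times slightly to the right of [t i] are controlled by
    [open_ex_times], and right-continuity leads back to [t i].  The complement
    of [F m] consists of the points whose box of radius [1 / m.+1] lies in
    [U]. *)
Lemma random_element_eval k (t : 'I_k -> {i01 R}) :
  random_element ((fun w i => Y w (t i)) : T -> {ptws 'I_k -> Dspace R}).
Proof.
apply: random_elementP => U oU.
pose F m : set {ptws 'I_k -> Dspace R} := [set y | exists2 z : {ptws 'I_k -> Dspace R},
  ~ U z & forall i, mdist (y i) (z i) < m.+1%:R^-1].
have oF m : open (F m).
  rewrite openE => y [z Uz yz]; apply/nbhs_boxP.
  have : \forall e \near 0^'+, forall i, mdist (y i) (z i) + e < m.+1%:R^-1.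
    apply: filter_forall => i; near=> e; rewrite -ltrBrDl.
    by near: e; apply: nbhs_right_lt; rewrite subr_gt0.
  move=> near_e; have [e [e0 eyz]] : exists e : R, 0 < e /\
      forall i, mdist (y i) (z i) + e < m.+1%:R^-1.
    by near (0 : R)^'+ => e; exists e; split; near: e; [exact: nbhs_right_gt|].
  exists e => // y' yy'; exists z => // i.
  rewrite (le_lt_trans (metric_triangle _ (y i) _))// addrC.
  by rewrite (lt_trans _ (eyz i))// ltrD2l metric_sym; exact: yy'.
pose A m j := [set x : DDspace R | exists u : 'I_k -> {i01 R},
    (forall i, right_nbhd j (t i) (u i)) /\ F m (fun i => x (u i))].
have oA m j : open (A m j).
  apply: (@open_ex_times _ _ (fun i => right_nbhd j (t i)) _ _ (oF m)) => i.
  exact: right_nbhd_stable.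
rewrite [X in measurable X](_ : _ =
    \bigcup_m \bigcup_j ~` (Y @^-1` (A m j))).
  apply: bigcupT_measurable => m; apply: bigcupT_measurable => j.
  by apply: measurableC; exact: (random_element_open mY (oA m j)).
apply/seteqP; split=> w /=.
  move=> Uw; have /nbhs_boxP[e e0 eU] :
      nbhs ((fun i => Y w (t i)) : {ptws 'I_k -> Dspace R}) U.
    exact: open_nbhs_nbhs.
  have e20 : 0 < e / 2 by rewrite divr_gt0.
  have [m _ /(_ m (leqnn m)) me] := near_infty_natSinv_lt (PosNum e20).
  have [j _ /(_ j (leqnn j)) jt] : \forall j \near \oo, forall i s,
      right_nbhd j (t i) s -> mdist (Y w (t i)) (Y w s) < e / 2.
    apply: filter_forall => i; apply: right_nbhd_near => //.
    exact: DDspace_cadlag.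
  exists m => //; exists j => // -[u [tu [z Uz uz]]]; apply: Uz; apply: eU => i.
  rewrite (le_lt_trans (metric_triangle _ (Y w (u i)) _))//.
  rewrite [ltRHS](splitr e) ltrD ?jt//.
  exact: lt_trans (uz i) me.
move=> [m _ [j _ nA]]; apply: contrapT => nU; apply: nA.
have m0 : 0 < m.+1%:R^-1 :> R by rewrite invr_gt0.
have : forall i, exists u, right_nbhd j (t i) u /\
    mdist (Y w (t i)) (Y w u) < m.+1%:R^-1.
  move=> i; have cY := @DDspace_cadlag _ (Y w).
  have [j' _ jt] := right_nbhd_near (t i) cY m0.
  pose J := maxn j j'; have [u ju] := right_nbhd_ex J (t i).
  have le : {homo (fun n : nat => n.+1%:R^-1 : R) : n p / (n <= p)%N >-> p <= n}.
    by move=> n p np; rewrite lef_pV2 ?posrE// ler_nat.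
  exists u; split; last by apply: (jt J) => //=; rewrite leq_maxr.
  move: ju; rewrite /right_nbhd; case: ifP => // _ /= /andP[->/=] ju.
  by rewrite (lt_le_trans ju)// lerD2l; apply: le; exact: leq_maxl.
move=> /choice[u tu]; exists u; split=> [i|]; first exact: (tu i).1.
exists (fun i => Y w (t i)) => // i; rewrite metric_sym; exact: (tu i).2.
Unshelve. all: by end_near. Qed.

End evaluation.

Section three_points.
Context (R : realType) (E : metricType R).

Definition three_dist (a b c : E) : R := Num.min (mdist a b) (mdist b c).

(** A triple with [t = r] reduces [three_dist] to a distance between two
    values. *)
Definition triple (S : Type) (r s t : S) : 'I_3 -> S :=
  fun i => nth t [:: r; s] i.

(** [three_dist] on the product space, where the convergence of the
    finite-dimensional laws is stated. *)
Definition three_dist_at (y : {ptws 'I_3 -> E}) : R :=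
  three_dist (y (@Ordinal 3 0 isT)) (y (@Ordinal 3 1 isT)) (y (@Ordinal 3 2 isT)).

Lemma dist_close (a b a' b' : E) (e : R) : mdist a a' < e / 2 ->
  mdist b b' < e / 2 -> `|mdist a b - mdist a' b'| < e.
Proof.
have arith (m m' q q' p p' : R) : q < e / 2 -> q' < e / 2 ->
    m <= q + p -> p <= m' + q' -> m' <= q + p' -> p' <= m + q' ->
    `|m - m'| < e.
  move=> *; rewrite ltr_norml; apply/andP; split; lra.
move=> aa bb; apply: (arith _ _ _ _ (mdist a' b) (mdist a b') aa bb).
- exact: metric_triangle.
- by rewrite (metric_sym b b'); exact: metric_triangle.
- by rewrite (metric_sym a a'); exact: metric_triangle.
- exact: metric_triangle.
Qed.

Lemma three_dist_at_continuous : continuous three_dist_at.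
Proof.
apply: box_continuous => y U /nbhs_ballP[e /= e0 eU].
exists (e / 2) => [|z yz]; first by rewrite divr_gt0.
apply: eU; rewrite /ball/=.
have := dist_close (yz (@Ordinal 3 0 isT)) (yz (@Ordinal 3 1 isT)).
have := dist_close (yz (@Ordinal 3 1 isT)) (yz (@Ordinal 3 2 isT)).
rewrite /three_dist_at /three_dist; move: (mdist _ _) (mdist _ _) (mdist _ _) (mdist _ _).
move=> a b c q; rewrite !ltr_norml => /andP[h1 h2] /andP[h3 h4].
by apply/andP; split; case: (leP c a); case: (leP q b) => *; lra.
Qed.

End three_points.

Section distance_events.
Context (R : realType) (d : measure_display) (T : measurableType d).
Context (Y : T -> DDspace R).
Hypothesis mY : random_element Y.

Lemma measurable_three_dist (c : R) r s t : measurable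
  [set w | c <= three_dist (Y w r) (Y w s) (Y w t)].
Proof.
have := measurable_ge (@three_dist_at_continuous R (Dspace R)) c
  (random_element_eval mY (triple r s t)).
by [].
Qed.

Lemma measurable_dist (c : R) r s : measurable
  [set w | c <= mdist (Y w r) (Y w s)].
Proof.
have := measurable_three_dist c r s r; congr (measurable _).
by apply/seteqP; split=> w /=; rewrite /three_dist (metric_sym (Y w s)) minxx.
Qed.

End distance_events.

(** * Continuity times *)

Section left_limits.
Context (R : realType).
Local Notation i0 := (0%:i01 : {i01 R}).
Local Notation i1 := (1%:i01 : {i01 R}).
Implicit Types (s t u : {i01 R}) (x : DDspace R).

Lemma continuous_i01P (E : metricType R) (x : {i01 R} -> E) t :
  {for t, continuous x} <-> forall e : R, 0 < e -> exists2 h : R, 0 < h &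
    forall u, `|t%:num - u%:num| < h -> mdist (x t) (x u) < e.
Proof.
split=> [xt e e0|xt A /nbhs_metricP[e e0 eA]].
  apply/i01_near; apply: (xt [set y | mdist (x t) y < e]).
  by apply/nbhs_metricP; exists e.
have [h h0 xh] := xt _ e0; apply/i01_near; exists h => // u tu.
by apply: eA; exact: xh.
Qed.

Lemma nbhs_lt_proper t : i0 < t -> ProperFilter (Defs.nbhs_lt t).
Proof.
move=> t0; apply: Build_ProperFilter_ex => A.
rewrite /Defs.nbhs_lt => /i01_near[e e0 eA].
have {}t0 : 0 < t%:num by exact: t0.
have t1 : t%:num <= 1 by exact: (i01_le1 t).
pose r : R := Num.min t%:num e / 2.
have r0 : 0 < r by rewrite divr_gt0// lt_min t0.
have rt : r * 2 <= t%:num by rewrite divfK// ge_min lexx.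
have re : r * 2 <= e by rewrite divfK// ge_min lexx orbT.
have u0 : 0 <= t%:num - r by lra.
have u1 : t%:num - r <= 1 by lra.
exists (Itv01 u0 u1); apply: eA.
  change (`|t%:num - (t%:num - r)| < e); rewrite opprB addrC subrK gtr0_norm//.
  lra.
by change (t%:num - r < t%:num); rewrite ltrBlDr ltrDl.
Qed.

Lemma left_limit_eq x t (l : Dspace R) : i0 < t ->
  (forall e : R, 0 < e -> exists2 h : R, 0 < h &
    forall s, t%:num - h < s%:num < t%:num -> mdist l (x s) < e) ->
  left_limit x t = l.
Proof.
move=> t0 xl; rewrite /left_limit gt_eqF//.
have PF := nbhs_lt_proper t0; apply: cvg_lim; first exact: metric_hausdorff.
move=> A /nbhs_metricP[e e0 eA]; have [h h0 xh] := xl _ e0.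
apply/i01_near; exists h => // s ts st; apply: eA; apply: xh.
by move: ts; rewrite ltr_norml => /andP[_ ts]; apply/andP; split=> //; lra.
Qed.

(** By right-continuity, having no jump at [t] is ordinary continuity at [t]; this
    also covers [t = 0], where both sides hold trivially. *)
Lemma left_limitP x t : (x t = left_limit x t) <->
  {for t, continuous (x : {i01 R} -> Dspace R)}.
Proof.
have cx := @DDspace_cadlag _ x.
have right (e : R) : 0 < e -> exists2 h : R, 0 < h &
    forall s, t%:num <= s%:num < t%:num + h -> mdist (x t) (x s) < e.
  exact: cadlag_right.
have [t0|] := ltP i0 t; last first.
  move=> t0; have -> : t = i0 by apply/le_anti; rewrite t0 i01_ge0.
  rewrite /left_limit eqxx; split=> // _; apply/continuous_i01P => e e0.
  have [h h0 xh] := cadlag_right i0 cx e0.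
  exists h => // u; rewrite ltr_distlC => /andP[_ uh]; apply: xh.
  by rewrite uh andbT; exact: (i01_ge0 u).
have [l xl] := cadlag_left cx t0; rewrite (left_limit_eq t0 xl).
split=> [xtl|/continuous_i01P xt].
  apply/continuous_i01P => e e0.
  have [h h0 xh] := right _ e0; have [f f0 xf] := xl _ e0.
  exists (Num.min h f); first by rewrite lt_min h0.
  move=> u; rewrite lt_min !ltr_distlC => /andP[/andP[uh1 uh2] /andP[uf1 uf2]].
  have [ut|tu] := ltP u%:num t%:num; first by rewrite xtl; apply: xf; rewrite uf1.
  by apply: xh; rewrite tu.
symmetry; rewrite -(left_limit_eq t0 xl); apply: left_limit_eq => // e e0.
have [h h0 xh] := xt _ e0; exists h => // s /andP[ts st].
by apply: xh; rewrite ltr_distlC ts/= (lt_le_trans st)// lerDl ltW.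
Qed.

(** Oscillation over an open interval, as an open condition: this is what makes
    jumps at a fixed time measurable. *)
Definition osc_gt (a b c : R) : set (DDspace R) :=
  [set x | exists u : 'I_2 -> {i01 R}, (forall i, a < (u i)%:num < b) /\
    c < mdist (x (u ord0)) (x (u ord_max))].

Lemma osc_gtI (a b c : R) x s u : a < s%:num < b -> a < u%:num < b ->
  c < mdist (x s) (x u) -> osc_gt a b c x.
Proof.
move=> sab uab xsu; exists (fun i => if i == ord0 then s else u); split=> //.
by move=> i; case: ifP.
Qed.

Lemma osc_gtS (a b a' b' c : R) : a' <= a -> b <= b' ->
  osc_gt a b c `<=` osc_gt a' b' c.
Proof.
move=> aa bb x [u [uab xc]]; exists u; split=> // i.
by have /andP[h1 h2] := uab i; rewrite (le_lt_trans aa)//= (lt_le_trans h2).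
Qed.

Lemma open_osc_gt (a b c : R) : open (osc_gt a b c).
Proof.
apply: (@open_ex_times _ 2 (fun=> [set t | a < t%:num < b])
  [set y | c < mdist (y ord0) (y ord_max)]) => [i|]; first exact: time_stable_itv.
rewrite openE => y /= yc; apply/nbhs_boxP.
pose e := (mdist (y ord0) (y ord_max) - c) / 2.
exists e => [|z yz]; first by rewrite divr_gt0// subr_gt0.
have arith (D f g m q : R) : D <= f + g -> g <= m + q -> f < (D - c) / 2 ->
  q < (D - c) / 2 -> c < m by lra.
apply: (arith _ _ _ _ _ (metric_triangle (y ord0) (z ord0) (y ord_max))
  (metric_triangle (z ord0) (z ord_max) (y ord_max))); first exact: yz.
by rewrite metric_sym; exact: yz.
Qed.

(** Continuity at [t] in terms of countably many open conditions on the path. *)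
Lemma continuous_i01_oscP x t : {for t, continuous (x : {i01 R} -> Dspace R)} <->
  forall k, exists j,
    ~ osc_gt (t%:num - j.+1%:R^-1) (t%:num + j.+1%:R^-1) k.+1%:R^-1 x.
Proof.
split=> [/continuous_i01P xt k|xt].
  have k0 : 0 < k.+1%:R^-1 / 2 :> R by rewrite divr_gt0// invr_gt0.
  have [h h0 xh] := xt _ k0.
  have [j _ /(_ j (leqnn j)) jh] := near_infty_natSinv_lt (PosNum h0).
  have uh u : t%:num - j.+1%:R^-1 < u%:num < t%:num + j.+1%:R^-1 ->
      mdist (x t) (x u) < k.+1%:R^-1 / 2.
    by rewrite -ltr_distlC => tu; apply: xh; exact: lt_trans jh.
  exists j => -[u [uj]]; apply/negP; rewrite -leNgt.
  rewrite (le_trans (metric_triangle _ (x t) _))//.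
  by rewrite [leRHS]splitr lerD// ltW ?uh// metric_sym uh.
apply/continuous_i01P => e e0.
have [k _ /(_ k (leqnn k)) ke] := near_infty_natSinv_lt (PosNum e0).
have [j nj] := xt k; exists j.+1%:R^-1; first by rewrite invr_gt0.
move=> u tu; rewrite ltNge; apply/negP => eu; apply: nj.
apply: (@osc_gtI _ _ _ _ t u); last exact: lt_le_trans ke eu.
  by rewrite ltrBlDr !ltrDl invr_gt0 ltr0n.
by move: tu; rewrite ltr_distlC.
Qed.

End left_limits.

Section continuity_times.
Context (R : realType) (d : measure_display) (T : measurableType d).
Context (P : probability T R) (Y : T -> DDspace R).
Hypothesis mY : random_element Y.
Local Notation i0 := (0%:i01 : {i01 R}).
Local Notation i1 := (1%:i01 : {i01 R}).

Definition continuity_times : set {i01 R} :=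
  [set t | P [set w | Y w t = left_limit (Y w) t] = 1%E].

Lemma measurable_continuity t :
  measurable [set w | Y w t = left_limit (Y w) t].
Proof.
pose A k j := osc_gt (t%:num - j.+1%:R^-1) (t%:num + j.+1%:R^-1) (k.+1%:R^-1 : R).
rewrite [X in measurable X](_ : _ = \bigcap_k \bigcup_j ~` (Y @^-1` (A k j))).
  apply: bigcapT_measurable => k; apply: bigcupT_measurable => j.
  by apply: measurableC; apply: (random_element_open mY); exact: open_osc_gt.
apply/seteqP; split=> w /=.
  move=> /left_limitP/continuous_i01_oscP Yw k _.
  by have [j nj] := Yw k; exists j.
move=> Yw; apply/left_limitP/continuous_i01_oscP => k.
by have [j _ nj] := Yw k I; exists j.
Qed.

Lemma continuity_timesP t :
  P.-negligible [set w | Y w t <> left_limit (Y w) t] -> continuity_times t.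
Proof.
move=> neg; have mC := measurable_continuity t; rewrite /continuity_times /=.
have /(probability_setC P) := measurableC mC; rewrite setCK => ->.
rewrite (measure_negligible _ neg) ?sube0//; exact: measurableC.
Qed.

Lemma continuity_times0 : continuity_times i0.
Proof.
rewrite /continuity_times /= (_ : [set w | _] = setT) ?probability_setT//.
by apply/seteqP; split=> // w _ /=; rewrite /left_limit eqxx.
Qed.

(** The intervals shrink to the empty set from the right of [a], where the path
    has a limit; so the events decrease to the empty set. *)
Lemma small_osc_right (a b e : R) : 0 <= a -> a < b -> b <= 1 -> 0 < e ->
  exists2 b' : R, a < b' <= b & (P (Y @^-1` (osc_gt a b' e)) < e%:E)%E.
Proof.
move=> a0 ab b1 e0; have a1 : a <= 1 by rewrite (le_trans (ltW ab)).
pose c : {i01 R} := Itv01 a0 a1.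
pose h (m : nat) : R := a + (b - a) / m.+1%:R.
have ha m : a < h m by rewrite ltrDl divr_gt0// subr_gt0.
have hb m : h m <= b.
  by rewrite -lerBrDl ler_pdivrMr// ler_peMr ?subr_ge0 ?ler1n// ltW.
have hS m n : (m <= n)%N -> h n <= h m.
  move=> mn; rewrite lerD2l ler_wpM2l ?subr_ge0 ?(ltW ab)//.
  by rewrite lef_pV2 ?posrE// ler_nat.
pose A m := Y @^-1` (osc_gt a (h m) e).
have mA m : measurable (A m) by apply: (random_element_open mY); exact: open_osc_gt.
have : P (A m) @[m --> \oo] --> P (\bigcap_m A m).
  apply: nonincreasing_cvg_mu => //.
  - exact: le_lt_trans (probability_le1 _ (mA _)) (ltry _).
  - exact: bigcapT_measurable.
  - by move=> m n mn; apply/subsetPset => w; apply: osc_gtS => //; exact: hS.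
rewrite (_ : \bigcap_m A m = set0) ?measure0; last first.
  apply/seteqP; split=> // w Aw.
  have e20 : 0 < e / 2 by rewrite divr_gt0.
  have [f f0 fY] := cadlag_right c (@DDspace_cadlag _ (Y w)) e20.
  have fba : 0 < f / (b - a) by rewrite divr_gt0// subr_gt0.
  have [m _ /(_ m (leqnn m)) mf] := near_infty_natSinv_lt (PosNum fba).
  have hf : h m <= a + f.
    rewrite lerD2l -ler_pdivlMl ?subr_gt0// mulrC; exact: ltW.
  have [u [uab]] := Aw m I; apply/negP; rewrite -leNgt.
  have uf i : mdist (Y w c) (Y w (u i)) < e / 2.
    have /andP[h1 h2] := uab i; apply: fY.
    change (a <= (u i)%:num < a + f); rewrite ltW//=; exact: lt_le_trans hf.
  rewrite (le_trans (metric_triangle _ (Y w c) _))// [leRHS](splitr e) lerD//.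
    by rewrite metric_sym ltW.
  by rewrite ltW.
move=> /(_ _) PA; have : \forall m \near \oo, (P (A m) < e%:E)%E.
  have /PA : nbhs 0%E [set x : \bar R | (x < e%:E)%E].
    by apply: open_nbhs_nbhs; split; [exact: open_ereal_lt_ereal|rewrite /= lte_fin].
  exact.
by move=> [m _ /(_ m (leqnn m)) mP]; exists (h m); rewrite ?ha ?hb.
Qed.

(** Nested open intervals [p m], each with closure inside the preceding one, such
    that the oscillation over [p m.+1] exceeds [1 / m.+1] with probability below
    [1 / m.+1].  A jump at their common point [sup S] makes the oscillation exceed
    this bound for all late [m], which is a null event by [liminf_null]. *)
Lemma continuity_times_dense (a b : {i01 R}) : a < b ->
  exists2 t, continuity_times t & a < t < b.
Proof.
move=> ab.
pose ok (p : R * R) := [/\ 0 <= p.1, p.1 < p.2 & p.2 <= 1].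
pose A m (p : R * R) := Y @^-1` (osc_gt p.1 p.2 m.+1%:R^-1).
(* Starting the new interval at the midpoint and bounding it by [c'] keeps its
     closure inside the old one. *)
have step (mp : nat * (R * R)) : exists q, let: (m, p) := mp in
    ok p -> [/\ ok q, p.1 < q.1, q.2 < p.2 &
    (P (A m q) < m.+1%:R^-1%:E)%E].
  case: mp => m p; have [okp|nok] := pselect (ok p); last by exists p.
  case: okp => p0 p12 p1; pose c := (p.1 + p.2) / 2; pose c' := (c + p.2) / 2.
  have [|||| b' /andP[cb bc] Pb] := @small_osc_right c c' m.+1%:R^-1.
  - rewrite /c; lra.
  - rewrite /c' /c; lra.
  - rewrite /c' /c; lra.
  - by rewrite invr_gt0.
  exists (c, b') => _; split => //=; last 2 first.
  - rewrite /c; lra.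
  - move: bc; rewrite /c' /c; lra.
  by split=> //=; move: bc; rewrite /c' /c; lra.
have [f fP] := choice step.
pose p m : R * R := iteri m (fun i q => f (i, q)) (a%:num, b%:num).
have okp m : ok (p m).
  elim: m => [|m okm]; last by have [] := fP (m, p m) okm.
  split=> /=; [exact: (i01_ge0 a)|exact: ab|exact: (i01_le1 b)].
have pS m : [/\ (p m).1 < (p m.+1).1, (p m.+1).2 < (p m).2 &
    (P (A m (p m.+1)) < m.+1%:R^-1%:E)%E].
  by have [] := fP (m, p m) (okp m).
have p1 m n : (m <= n)%N -> (p m).1 <= (p n).1.
  elim: n => [|n IH]; first by rewrite leqn0 => /eqP ->.
  rewrite leq_eqVlt => /predU1P[->//|]; rewrite ltnS => /IH mn.
  by have [/ltW pn _ _] := pS n; exact: le_trans mn pn.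
have p2 m n : (m <= n)%N -> (p n).2 <= (p m).2.
  elim: n => [|n IH]; first by rewrite leqn0 => /eqP ->.
  rewrite leq_eqVlt => /predU1P[->//|]; rewrite ltnS => /IH mn.
  by have [_ /ltW pn _] := pS n; exact: le_trans pn mn.
have p12 m n : (p m).1 <= (p n).2.
  have [mn|/ltnW nm] := leqP m n.
    by rewrite (le_trans (p1 _ _ mn))// ltW//; have [] := okp n.
  by rewrite (le_trans _ (p2 _ _ nm))// ltW//; have [] := okp m.
pose S : set R := range (fun m => (p m).1).
have supS : has_sup S.
  split; first by exists (p 0%N).1; exists 0%N.
  by exists (p 0%N).2 => _ [m _ <-].
have S_ge m : (p m).1 < sup S.
  have [pm _ _] := pS m; apply: (lt_le_trans pm).
  by apply: ub_le_sup; [exact: supS.2|exists m.+1].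
have S_le m : sup S < (p m).2.
  have [_ pm _] := pS m; apply: le_lt_trans pm.
  by apply: ge_sup; [exact: supS.1|move=> _ [n _ <-]].
have S0 : 0 <= sup S.
  by rewrite (le_trans _ (ltW (S_ge 0%N)))//; exact: (i01_ge0 a).
have S1 : sup S <= 1.
  by rewrite (le_trans (ltW (S_le 0%N)))//; exact: (i01_le1 b).
exists (Itv01 S0 S1); last by apply/andP; split; [exact: (S_ge 0%N)|exact: (S_le 0%N)].
apply: continuity_timesP.
have mA m : measurable (A m (p m.+1)).
  by apply: (random_element_open mY); exact: open_osc_gt.
have := @liminf_null _ _ _ P (fun m => A m (p m.+1)) mA.
suff PA : P (A m (p m.+1)) @[m --> \oo] --> 0%E.
  move=> /(_ PA); apply: negligibleS => w /= ncw.
  have : ~ {for Itv01 S0 S1, continuous (Y w : {i01 R} -> Dspace R)}.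
    by move/left_limitP.
  move=> /continuous_i01P/existsNP[e /not_implyP[e0 nh]].
  near=> m.
  pose h := Num.min (sup S - (p m.+1).1) ((p m.+1).2 - sup S).
  have h0 : 0 < h by rewrite lt_min !subr_gt0 S_ge S_le.
  have /existsNP[u /not_implyP[uh /negP]] : ~ (forall u : {i01 R},
      `|(Itv01 S0 S1)%:num - u%:num| < h ->
      mdist (Y w (Itv01 S0 S1)) (Y w u) < e).
    by move=> H; apply: nh; exists h.
  rewrite -leNgt => eu; apply: (@osc_gtI _ _ _ _ _ (Itv01 S0 S1) u).
  - by change ((p m.+1).1 < sup S < (p m.+1).2); rewrite S_ge S_le.
  - move: uh; change (`|sup S - u%:num| < h -> (p m.+1).1 < u%:num < (p m.+1).2).
    rewrite lt_min !ltr_distlC => /andP[/andP[h1 _] /andP[_ h2]].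
    by apply/andP; split; lra.
  - apply: lt_le_trans eu; near: m; exact: (near_infty_natSinv_lt (PosNum e0)).
apply: (@squeeze_cvge _ _ _ _ (cst 0%E) _ (fun m => (m.+1%:R^-1)%:E)).
- apply: nearW => m; rewrite measure_ge0/=; apply: ltW; by have [] := pS m.
- exact: cvg_cst.
- apply: cvg_EFin; first exact: nearW.
  apply/cvgrPdist_lt => e e0; near=> m.
  rewrite sub0r normrN ger0_norm ?invr_ge0//.
  by near: m; exact: (near_infty_natSinv_lt (PosNum e0)).
Unshelve. all: by end_near. Qed.

Hypothesis left_cont1 : forall eps : R, 0 < eps ->
  P [set w | eps <= dJ1 (Y w 1%:i01) (Y w (1 - delta%:num)%:i01)]
    @[delta --> nbhs_gt (0%:i01 : {i01 R})] --> 0%E.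

Lemma left_cont1_near (e q : R) : 0 < e -> 0 < q -> exists2 h : R, 0 < h &
  forall s, 1 - h < s%:num < 1 ->
    (P [set w | (e <= mdist (Y w i1) (Y w s))%R] < q%:E)%E.
Proof.
move=> e0 q0; have /(_ [set x : \bar R | (x < q%:E)%E]) := left_cont1 e0.
have nq : nbhs 0%E [set x : \bar R | (x < q%:E)%E].
  by apply: open_nbhs_nbhs; split; [exact: open_ereal_lt_ereal|rewrite /= lte_fin].
move=> /(_ nq)/i01_near[h h0 hP]; exists h => // s /andP[hs s1].
have s0 : 0 <= s%:num by exact: (i01_ge0 s).
have d0 : 0 <= 1 - s%:num by lra.
have d1 : 1 - s%:num <= 1 by lra.
have := hP (Itv01 d0 d1); rewrite /=.
have -> : (1 - (Itv01 d0 d1)%:num)%:i01 = s :> {i01 R}.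
  by apply: val_inj => /=; rewrite opprB addrC subrK.
apply; first by rewrite sub0r normrN ger0_norm//; lra.
by change (0 < 1 - s%:num); lra.
Qed.

(** A jump at 1 is the limit of the distances to the values at any times that
    increase to 1, and these tend to 0 in probability. *)
Lemma continuity_times1 : continuity_times i1.
Proof.
apply: continuity_timesP.
have m0 m : 0 < m.+1%:R^-1 :> R by rewrite invr_gt0.
have : forall m, exists s, 1 - m.+1%:R^-1 < s%:num < 1 /\
    (P [set w | (m.+1%:R^-1 <= mdist (Y w i1) (Y w s))%R] < m.+1%:R^-1%:E)%E.
  move=> m; have [h h0 hP] := left_cont1_near (m0 m) (m0 m).
  pose r : R := Num.min 1 (Num.min m.+1%:R^-1 h) / 2.
  have r0 : 0 < r by rewrite divr_gt0// !lt_min ltr01 m0.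
  have r1 : r * 2 <= 1 by rewrite divfK// ge_min lexx.
  have rm : r < m.+1%:R^-1.
    rewrite (@lt_le_trans _ _ (r * 2))// ?ltr_pMr ?ltr1n//.
    by rewrite divfK// !ge_min lexx orbT.
  have rh : r < h.
    rewrite (@lt_le_trans _ _ (r * 2))// ?ltr_pMr ?ltr1n//.
    by rewrite divfK// !ge_min lexx !orbT.
  have s0 : 0 <= 1 - r by lra.
  have s1 : 1 - r <= 1 by lra.
  exists (Itv01 s0 s1); split; last apply: hP; rewrite /=;
    change (1 - m.+1%:R^-1 < 1 - r < 1) || change (1 - h < 1 - r < 1);
    by rewrite ltrD2l ltrN2 gtrBl r0 andbT.
move=> /choice[s sP].
have mA m : measurable [set w | m.+1%:R^-1 <= mdist (Y w i1) (Y w (s m))].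
  exact: measurable_dist.
have null := @liminf_null _ _ _ P _ mA.
apply: (negligibleS _ (null _)).
  move=> w /= ncw.
  have [l lY] := cadlag_left (@DDspace_cadlag _ (Y w)) (ltr01 : i0 < i1).
  rewrite (left_limit_eq (ltr01 : i0 < i1) lY) in ncw.
  have c0 : 0 < mdist (Y w i1) l / 2 by rewrite divr_gt0// mdist_gt0; exact/eqP.
  have [h h0 hY] := lY _ c0.
  near=> m.
  have mc : m.+1%:R^-1 < mdist (Y w i1) l / 2.
    by near: m; exact: (near_infty_natSinv_lt (PosNum c0)).
  have mh : m.+1%:R^-1 < h.
    by near: m; exact: (near_infty_natSinv_lt (PosNum h0)).
  have [/andP[sm1 sm2] _] := sP m.
  have ls : mdist l (Y w (s m)) < mdist (Y w i1) l / 2.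
    apply: hY; rewrite sm2 andbT (lt_trans _ sm1)// ltrD2l ltrN2//.
  have arith (a b c q : R) : q < a / 2 -> b < a / 2 -> a <= c + b -> q <= c by lra.
  apply: (arith _ _ _ _ mc ls); rewrite (metric_sym l).
  exact: metric_triangle.
apply: (@squeeze_cvge _ _ _ _ (cst 0%E) _ (fun m => (m.+1%:R^-1)%:E)).
- apply: nearW => m; rewrite measure_ge0/=; apply: ltW; by have [] := sP m.
- exact: cvg_cst.
- apply: cvg_EFin; first exact: nearW.
  apply/cvgrPdist_lt => e e0; near=> m.
  rewrite sub0r normrN ger0_norm ?invr_ge0//.
  by near: m; exact: (near_infty_natSinv_lt (PosNum e0)).
Unshelve. all: by end_near. Qed.

End continuity_times.

(** * Dyadic partitions *)

Section partitions.
Context (R : realType).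
Local Notation i0 := (0%:i01 : {i01 R}).
Local Notation i1 := (1%:i01 : {i01 R}).
Implicit Types (s t u a b : {i01 R}).

Definition clamp (r : R) : R := Num.max 0 (Num.min 1 r).

Lemma clamp_ge0 r : 0 <= clamp r. Proof. by rewrite le_max lexx. Qed.

Lemma clamp_le1 r : clamp r <= 1.
Proof. by rewrite ge_max ler01 ge_min lexx. Qed.

(** The unit interval as a retract of the line, so that results on functions of a
    real variable transfer to functions of [{i01 R}]. *)
Definition to_i01 (r : R) : {i01 R} := Itv01 (clamp_ge0 r) (clamp_le1 r).

Lemma clamp_continuous : continuous clamp.
Proof.
apply: (@max_fun_continuous _ _ R); first by move=> v; exact: cvg_cst.
by apply: (@min_fun_continuous _ _ R) => v; [exact: cvg_cst|exact: cvg_id].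
Qed.

Lemma clamp_id r : 0 <= r <= 1 -> clamp r = r.
Proof. by move=> /andP[r0 r1]; rewrite /clamp (min_idPr r1) (max_idPr r0). Qed.

Lemma to_i01K t : to_i01 t%:num = t.
Proof.
apply: val_inj; apply: clamp_id; apply/andP; split.
  exact: (i01_ge0 t).
exact: (i01_le1 t).
Qed.

Lemma i01_IVT (G : {i01 R} -> R) a b (v : R) : continuous G -> a <= b ->
  G a <= v <= G b -> exists2 c, a <= c <= b & G c = v.
Proof.
move=> cG ab /andP[av vb].
have cg : continuous (G \o to_i01).
  move=> r; apply: continuous_comp; last exact: cG.
  move=> A /i01_near[e e0 eA].
  have /cvgrPdist_lt/(_ _ e0) := @clamp_continuous r.
  by apply: filterS => r' rr'; apply: eA.
have ab' : a%:num <= b%:num by exact: ab.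
have [|c /itvP cab <-] := @IVT _ (G \o to_i01) a%:num b%:num v ab'
    (continuous_subspaceT cg).
  by rewrite /= !to_i01K ge_min av le_max vb orbT.
exists (to_i01 c) => //.
have a0 : 0 <= a%:num by exact: (i01_ge0 a).
have b1 : b%:num <= 1 by exact: (i01_le1 b).
have cE : clamp c = c.
  by rewrite clamp_id// (le_trans a0) ?(le_trans _ b1) ?cab.
by apply/andP; split; [change (a%:num <= clamp c)|change (clamp c <= b%:num)];
  rewrite cE cab.
Qed.

(** A non-decreasing continuous function becomes a gauge when the identity is
    added to it.  Small increments of a gauge bound the mesh of a partition as
    well as the moments of the process. *)
Record gauge (G : {i01 R} -> R) : Prop := Gauge {
  gauge_cont : continuous G ;
  gauge_le : forall s t, s <= t -> t%:num - s%:num <= G t - G s }.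

Lemma gauge_lt G s t : gauge G -> s < t -> G s < G t.
Proof.
move=> gG st; have := gauge_le gG (ltW st).
by rewrite -subr_gt0; apply: lt_le_trans; rewrite subr_gt0.
Qed.

Lemma gauge_mono G s t : gauge G -> s <= t -> G s <= G t.
Proof.
by move=> gG; rewrite le_eqVlt => /predU1P[->//|/(gauge_lt gG)/ltW].
Qed.

Definition gauge_mass (G : {i01 R} -> R) : R := G i1 - G i0.

Lemma gauge_mass_ge0 G : gauge G -> 0 <= gauge_mass G.
Proof.
by move=> gG; rewrite subr_ge0; apply: (gauge_mono gG); exact: i01_ge0.
Qed.

(** Exact halving may be impossible inside [S]; any ratio [rho] above one half
    leaves room to move the cut point into the dense set [S]. *)
Lemma gauge_midpoint G (S : set {i01 R}) (rho : R) a b : gauge G ->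
  (forall s t, s < t -> exists2 u, S u & s < u < t) ->
  2^-1 < rho -> a < b -> exists u, [/\ S u, a < u < b,
    G u - G a <= rho * (G b - G a) & G b - G u <= rho * (G b - G a)].
Proof.
move=> gG dS rho2 ab; have Gab := gauge_lt gG ab.
pose U := G b - G a; have U0 : 0 < U by rewrite subr_gt0.
have [|c /andP[ac cb] Gc] := @i01_IVT G a b (G a + U / 2) (gauge_cont gG) (ltW ab).
  by rewrite /U; apply/andP; split; move: Gab; move: (G a) (G b) => x y; lra.
have {}cb : c < b.
  rewrite lt_neqAle cb andbT; apply/eqP => cb'; move: Gc; rewrite cb' /U.
  by move: Gab; move: (G a) (G b) => x y; lra.
have e0 : 0 < (rho - 2^-1) * U by rewrite mulr_gt0// subr_gt0.
have : G u @[u --> c] --> G c by exact: gauge_cont.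
move=> /cvgrPdist_lt/(_ _ e0)/i01_near[h h0 hG].
have [|u Su /andP[cu ub]] := dS c (Num.min b (to_i01 (c%:num + h))).
  rewrite lt_min cb /=; change (c%:num < clamp (c%:num + h)).
  have c0 : 0 <= c%:num by exact: (i01_ge0 c).
  have c1 : c%:num < 1 by apply: lt_le_trans cb (i01_le1 b).
  by rewrite lt_max lt_min c1 ltrDl h0 orbT.
move: ub; rewrite lt_min => /andP[ub uh].
have {}uh : u%:num < c%:num + h.
  move: uh; change (u%:num < clamp (c%:num + h) -> u%:num < c%:num + h).
  have u0 : 0 <= u%:num by exact: (i01_ge0 u).
  by rewrite lt_max lt_min ltNge u0 /= => /andP[].
have : `|G c - G u| < (rho - 2^-1) * U.
  apply: hG; rewrite ltr_distlC uh andbT.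
  by rewrite (lt_le_trans _ (ltW (cu : c%:num < u%:num)))// gtrBl.
have Gcu := gauge_lt gG cu.
rewrite ltr_norml => /andP[Gcu' _].
have rU : rho * U = (rho - 2^-1) * U + U / 2 by rewrite mulrBl mulrC; lra.
exists u; split => //; first by rewrite ub (le_lt_trans ac cu).
- by rewrite -/U rU -lerBrDr; move: Gc Gcu'; move: (_ * U) (G a) (G c) (G u) => *; lra.
- have GbE : G b = G a + U by rewrite /U addrC subrK.
  rewrite -/U rU GbE; move: Gc Gcu e0.
  by move: ((rho - _) * U) (G c) (G u) => *; lra.
Qed.

(** Level [k] of [p] lists the end points of [2 ^ k] consecutive windows of
    [0,1]; level [k.+1] cuts each window once. *)
Record dyadic_partitions (S : set {i01 R}) (G : {i01 R} -> R) (rho : R)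
    (p : nat -> nat -> {i01 R}) : Prop := DyadicPartitions {
  part_first : forall k, p k 0%N = i0 ;
  part_last : forall k, p k (2 ^ k)%N = i1 ;
  part_refine : forall k i, p k.+1 i.*2 = p k i ;
  part_in : forall k i, (i <= 2 ^ k)%N -> S (p k i) ;
  part_lt : forall k i, (i < 2 ^ k)%N -> p k i < p k i.+1 ;
  part_gauge : forall k i, (i < 2 ^ k)%N ->
    G (p k i.+1) - G (p k i) <= rho ^+ k * gauge_mass G }.

Fixpoint dyadic_points (mid : {i01 R} * {i01 R} -> {i01 R}) (k i : nat)
    {struct k} : {i01 R} :=
  if k is k'.+1 then
    if odd i then
      mid (dyadic_points mid k' i./2, dyadic_points mid k' i./2.+1)
    else dyadic_points mid k' i./2
  else if i is 0 then i0 else i1.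

Lemma dyadic_partitions_exist G (S : set {i01 R}) (rho : R) : gauge G ->
  (forall s t, s < t -> exists2 u, S u & s < u < t) -> S i0 -> S i1 ->
  2^-1 < rho -> exists p, dyadic_partitions S G rho p.
Proof.
move=> gG dS S0 S1 rho2.
have : forall ab : {i01 R} * {i01 R}, exists u, ab.1 < ab.2 ->
    [/\ S u, ab.1 < u < ab.2, G u - G ab.1 <= rho * (G ab.2 - G ab.1) &
      G ab.2 - G u <= rho * (G ab.2 - G ab.1)].
  move=> [a b] /=; have [ab|] := ltP a b; last by exists a.
  by have [u uP] := gauge_midpoint gG dS rho2 ab; exists u.
move=> /choice[mid midP].
pose p := dyadic_points mid.
have pE k i : p k.+1 i.*2 = p k i by rewrite /p/= odd_double doubleK.
have pO k i : p k.+1 i.*2.+1 = mid (p k i, p k i.+1).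
  by rewrite /p/= odd_double/= uphalf_double.
have main k i : (i < 2 ^ k)%N -> [/\ S (p k i), S (p k i.+1), p k i < p k i.+1 &
    G (p k i.+1) - G (p k i) <= rho ^+ k * gauge_mass G].
  elim: k i => [|k IH] i.
    rewrite expn0 ltnS leqn0 => /eqP -> /=; split => //.
    by rewrite expr0 mul1r.
  rewrite expnS mul2n => ik.
  have i2k : (i./2 < 2 ^ k)%N.
    rewrite -ltn_double; apply: leq_ltn_trans ik.
    by rewrite -[leqRHS]odd_double_half leq_addl.
  have [Sa Sb ab Gab] := IH _ i2k.
  have [Su /andP[au ub] G1 G2] := midP (p k i./2, p k i./2.+1) ab.
  have rho0 : 0 < rho by apply: lt_trans rho2; rewrite invr_gt0.
  have le_rho : rho * (G (p k i./2.+1) - G (p k i./2)) <=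
      rho ^+ k.+1 * gauge_mass G.
    by rewrite exprS -mulrA ler_wpM2l// ltW.
  rewrite -[i]odd_double_half; case: (odd i); rewrite ?add0n ?add1n.
    rewrite pO -doubleS pE; split => //; exact: le_trans le_rho.
  rewrite pO pE; split => //; exact: le_trans le_rho.
have p_last k : p k (2 ^ k)%N = i1.
  elim: k => [//|k IH]; by rewrite expnS mul2n pE.
exists p; split.
- by elim=> [//|k IH]; rewrite -[0%N]/(0.*2) pE.
- exact: p_last.
- exact: pE.
- move=> k i; rewrite leq_eqVlt => /predU1P[->|/main[]//]; by rewrite p_last.
- by move=> k i /main[].
- by move=> k i /main[].
Qed.

End partitions.

(** * Chaining *)

Section chaining.
Context (R : realType) (E : metricType R).
Implicit Types (x : {i01 R} -> E) (r s t : {i01 R}).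
Local Notation i1 := (1%:i01 : {i01 R}).

Lemma three_dist_close (a b c a' b' c' : E) (e : R) : mdist a a' <= e ->
  mdist b b' <= e -> mdist c c' <= e ->
  three_dist a b c <= three_dist a' b' c' + 2 * e.
Proof.
have arith (m m' q q' p : R) : q <= e -> q' <= e ->
    m <= q + p -> p <= m' + q' -> m <= m' + 2 * e.
  move=> *; lra.
move=> aa bb cc; rewrite /three_dist addr_minl le_min !ge_min.
apply/andP; split; apply/orP; [left|right].
  apply: (arith _ _ _ _ (mdist a' b) aa bb); first exact: metric_triangle.
  by rewrite (metric_sym b b'); exact: metric_triangle.
apply: (arith _ _ _ _ (mdist b' c) bb cc); first exact: metric_triangle.
by rewrite (metric_sym c c'); exact: metric_triangle.
Qed.

(** Each point of level [j.+1] is moved to the closer of its neighbours at level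
    [j]; as this is monotone in the index, it changes [three_dist] by at most
    twice the displacement. *)
Lemma dyadic_chaining (z : nat -> nat -> E) (eps : nat -> R) :
  (forall j, 0 <= eps j) ->
  (forall j i, z j.+1 i.*2 = z j i) ->
  (forall j i, (i < 2 ^ j)%N ->
     three_dist (z j i) (z j.+1 i.*2.+1) (z j i.+1) <= eps j) ->
  forall j a b c, (a <= b)%N -> (b <= c)%N -> (c <= 2 ^ j)%N ->
    three_dist (z j a) (z j b) (z j c) <= 2 * \sum_(q < j) eps q.
Proof.
move=> eps0 zE zO; elim=> [|j IH] a b c ab bc c2.
  rewrite big_ord0 mulr0 /three_dist ge_min.
  move: c2; rewrite expn0; case: c bc => [|[|//]] bc _.
    by move: bc ab; rewrite leqn0 => /eqP ->; rewrite leqn0 => /eqP ->; rewrite mdistxx lexx.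
  case: b ab bc => [|[|//]] ab _; last by rewrite mdistxx lexx orbT.
  by move: ab; rewrite leqn0 => /eqP ->; rewrite mdistxx lexx.
(* An even index stays in place, an odd one moves to one of its neighbours. *)
have : forall i, exists i', (i <= 2 ^ j.+1)%N -> [/\ (i./2 <= i')%N,
    (i' <= uphalf i)%N & mdist (z j.+1 i) (z j i') <= eps j].
  move=> i; have [ij|] := leqP i (2 ^ j.+1); last by exists 0%N.
  suff [i' ?] : exists i', [/\ (i./2 <= i')%N, (i' <= uphalf i)%N &
    mdist (z j.+1 i) (z j i') <= eps j] by exists i'.
  move: ij; rewrite expnS mul2n => ij; rewrite -[i]odd_double_half.
  case oi: (odd i); last first.
    exists i./2; rewrite add0n doubleK uphalf_double leqnn; split => //.
    by rewrite zE mdistxx.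
  have i2 : (i./2 < 2 ^ j)%N.
    by rewrite -ltn_double; apply: leq_trans ij; rewrite -[leqRHS]odd_double_half oi.
  have := zO _ _ i2; rewrite add1n /= uphalf_double doubleK /three_dist ge_min.
  move=> /orP[|] h.
    by exists i./2; split => //; rewrite metric_sym.
  by exists i./2.+1; split.
move=> /choice[f fP].
have mono i k : (k <= 2 ^ j.+1)%N -> (i <= k)%N -> (f i <= f k)%N.
  move=> k2; rewrite leq_eqVlt => /predU1P[->//|ik].
  have [_ fi _] := fP i (leq_trans (ltnW ik) k2); have [fk _ _] := fP k k2.
  exact: leq_trans fi (leq_trans (half_leq ik) fk).
have b2 := leq_trans bc c2; have a2 := leq_trans ab b2.
have [_ _ aa] := fP a a2; have [_ _ bb] := fP b b2; have [_ fc cc] := fP c c2.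
rewrite big_ord_recr/= mulrDr (le_trans (three_dist_close aa bb cc))// lerD2r.
apply: IH; [exact: mono|exact: mono|apply: leq_trans fc _].
have := half_leq (c2 : (c.+1 <= (2 ^ j.+1).+1)%N).
by rewrite expnS mul2n /= uphalf_double.
Qed.

(** Every window of level [K] inherits from the dyadic points a bound for all
    its triples, because the path is right-continuous. *)
Lemma window_three_dist (S : set {i01 R}) G (rho : R) p (eps : nat -> R) (e : R)
    x K i :
  gauge G -> 0 <= rho < 1 -> dyadic_partitions S G rho p -> cadlag x ->
  (forall k, 0 <= eps k) -> (forall j, 2 * \sum_(q < j) eps (K + q)%N <= e) ->
  (forall k l, (K <= k)%N -> (l < 2 ^ k)%N ->
    three_dist (x (p k l)) (x (p k.+1 l.*2.+1)) (x (p k l.+1)) <= eps k) ->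
  (i < 2 ^ K)%N ->
  forall r s t, p K i <= r -> r <= s -> s <= t -> t <= p K i.+1 ->
    three_dist (x r) (x s) (x t) <= e.
Proof.
move=> gG /andP[rho0 rho1] pP cx eps0 epse xp iK.
pose z j l := p (K + j)%N (2 ^ j * i + l)%N.
have zE j l : z j.+1 l.*2 = z j l.
  by rewrite /z expnS -mulnA mul2n -doubleD addnS (part_refine pP).
have zlt j l : (l < 2 ^ j)%N -> (2 ^ j * i + l < 2 ^ (K + j))%N.
  move=> lj; rewrite expnD mulnC (@leq_trans (i.+1 * 2 ^ j)%N)//.
    by rewrite mulSn addnC ltn_add2r.
  by rewrite leq_mul2r iK orbT.
have z_first j : z j 0%N = p K i.
  elim: j => [|j IH]; first by rewrite /z addn0 expn0 mul1n addn0.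
  by rewrite -[0%N]/(0.*2) zE.
have z_last j : z j (2 ^ j)%N = p K i.+1.
  elim: j => [|j IH]; first by rewrite /z addn0 expn0 mul1n addn1.
  by rewrite expnS mul2n zE.
have z_step j l : (l < 2 ^ j)%N -> z j l < z j l.+1.
  by move=> lj; rewrite /z addnS; apply: (part_lt pP); exact: zlt.
have z_mono j l m : (l <= m)%N -> (m <= 2 ^ j)%N -> z j l <= z j m.
  elim: m => [|m IH]; first by rewrite leqn0 => /eqP ->.
  rewrite leq_eqVlt => /predU1P[->//|]; rewrite ltnS => lm mj.
  by rewrite (le_trans (IH lm (ltnW mj)))// ltW// z_step.
have dyadic j a b c : (a <= b)%N -> (b <= c)%N -> (c <= 2 ^ j)%N ->
    three_dist (x (z j a)) (x (z j b)) (x (z j c)) <= e.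
  move=> ab bc cj; apply: le_trans (epse j).
  apply: (@dyadic_chaining (fun j l => x (z j l)) (fun j => eps (K + j)%N)) => //.
    by move=> j' l; rewrite zE.
  move=> j' l lj; have := xp (K + j')%N (2 ^ j' * i + l)%N (leq_addr _ _) (zlt _ _ lj).
  rewrite /z addnS; congr (three_dist _ (x (p _ _)) (x (p _ _)) <= _).
    by rewrite doubleD expnS -mulnA mul2n addnS.
  by rewrite addnS.
have approx (h : R) : 0 < h -> exists j, forall s, p K i <= s -> s <= p K i.+1 ->
    exists l, [/\ (l <= 2 ^ j)%N, s <= z j l & (z j l)%:num < s%:num + h].
  move=> h0; pose U := gauge_mass G; have U0 : 0 <= U := gauge_mass_ge0 gG.
  have : rho ^+ n * U @[n --> \oo] --> 0.
    rewrite -(mul0r U); apply: cvgM; last exact: cvg_cst.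
    by apply: cvg_expr; rewrite ger0_norm.
  move=> /cvgrPdist_lt/(_ _ h0)[N _ NP]; exists N => s is_ si.
  have ex : exists l, s <= z N l by exists (2 ^ N)%N; rewrite z_last.
  case: (ex_minnP ex) => l sl lmin.
  have lN : (l <= 2 ^ N)%N by apply: lmin; rewrite z_last.
  exists l; split => //; case: l => [|l] in sl lmin lN *.
    have -> : s = z N 0%N by apply/le_anti; rewrite sl z_first.
    by rewrite ltrDl.
  have ls : z N l < s by rewrite ltNge; apply/negP => /lmin; rewrite ltnn.
  have := gauge_le gG (ltW (z_step _ _ lN)).
  have := part_gauge pP (zlt _ _ lN); rewrite -addnS => h1 h2.
  have := le_trans h2 h1; rewrite exprD -mulrA.
  have : rho ^+ K * (rho ^+ N * U) <= rho ^+ N * U.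
    by rewrite ler_piMl ?mulr_ge0 ?exprn_ile1 ?exprn_ge0 ?(ltW rho1).
  have := NP N (leqnn N); rewrite /= sub0r normrN ger0_norm; last first.
    by rewrite mulr_ge0 ?exprn_ge0.
  have : (z N l)%:num < s%:num by exact: ls.
  rewrite -/U; move: (rho ^+ K * (rho ^+ N * U)) (rho ^+ N * U) => A B; lra.
move=> r s t ir rs st ti; apply/ler_addgt0Pr => f f0.
have f20 : 0 < f / 2 by rewrite divr_gt0.
have e0 : 0 <= e.
  by apply: le_trans (epse 0%N); rewrite big_ord0 mulr0.
have nonneg : 0 <= e + f by rewrite addr_ge0// ltW.
(* Coinciding times give distance 0; for distinct times the dyadic
   approximations from the right keep the order. *)
move: rs; rewrite le_eqVlt => /predU1P[->|rs].
  by rewrite /three_dist ge_min mdistxx nonneg.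
move: st; rewrite le_eqVlt => /predU1P[->|st].
  by rewrite /three_dist ge_min mdistxx nonneg orbT.
have [hr hr0 xr] := cadlag_right r cx f20.
have [hs hs0 xs] := cadlag_right s cx f20.
have [ht ht0 xt] := cadlag_right t cx f20.
pose h := Num.min (Num.min hr (s%:num - r%:num)) (Num.min (Num.min hs (t%:num - s%:num)) ht).
have h0 : 0 < h by rewrite !lt_min hr0 hs0 ht0 !subr_gt0 !andbT/=; apply/andP.
have [hhr hhs hht hrs hst] : [/\ h <= hr, h <= hs, h <= ht, h <= s%:num - r%:num & h <= t%:num - s%:num].
  by split; rewrite /h !ge_min lexx ?orbT.
have [j jP] := approx h h0.
have [a [aj ra ar]] := jP r ir (le_trans (ltW rs) (le_trans (ltW st) ti)).
have [b [bj sb bs]] := jP s (le_trans ir (ltW rs)) (le_trans (ltW st) ti).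
have [c [cj tc ct]] := jP t (le_trans ir (le_trans (ltW rs) (ltW st))) ti.
have index l m : (m <= 2 ^ j)%N -> (z j m < z j l)%O -> (l <= 2 ^ j)%N -> (m <= l)%N.
  move=> mj ml lj; rewrite leqNgt; apply/negP => lm.
  by move: ml; rewrite ltNge (z_mono _ _ _ (ltnW lm)).
have ab : (a <= b)%N.
  apply: index => //; apply: lt_le_trans sb; change ((z j a)%:num < s%:num); lra.
have bc : (b <= c)%N.
  apply: index => //; apply: lt_le_trans tc; change ((z j b)%:num < t%:num); lra.
have close u l hu : (forall v, u%:num <= v%:num < u%:num + hu -> mdist (x u) (x v) < f / 2) ->
    h <= hu -> u <= z j l -> (z j l)%:num < u%:num + h ->
    mdist (x u) (x (z j l)) <= f / 2.
  move=> xu hhu ul lu; apply/ltW/xu; rewrite (lt_le_trans lu) ?lerD2l// andbT.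
  exact: ul.
have := three_dist_close (close _ _ _ xr hhr ra ar) (close _ _ _ xs hhs sb bs)
  (close _ _ _ xt hht tc ct).
move=> /le_trans; apply; rewrite mulrCA divff// mulr1 lerD2r.
exact: dyadic.
Qed.

End chaining.

(** * Step paths and time changes *)

Section window_jump.
Context (R : realType) (E : metricType R).
Implicit Types (x : {i01 R} -> E) (r s t a b : {i01 R}).

Let arith (e av vb ab as_ vs : R) (Q : Prop) : 0 <= e ->
  ab <= av + vb -> av <= as_ + vs -> vb <= e -> as_ <= e -> 3 * e < ab -> (av <= e) || (vs <= e) -> Q.
Proof. by move=> h0 h1 h2 h3 h4 h5 /orP[?|?]; exfalso; lra. Qed.

(** No value lies far from both [x a] and [x b].  If these are more than [3 * e]
    apart, then a time near [x b] cannot be followed by a time near [x a]: the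
    triple that starts at [a] would have a large [three_dist].  Hence the times
    near [x b] form a final segment, and [tau] is its first point.  If [x a] and
    [x b] are within [3 * e], then [tau = b] works. *)
Lemma window_jump x a b (e : R) : cadlag x -> a < b -> 0 <= e ->
  (forall r s t, a <= r -> r <= s -> s <= t -> t <= b ->
    three_dist (x r) (x s) (x t) <= e) ->
  exists tau, [/\ a < tau <= b,
    forall s, a <= s -> s < tau -> mdist (x a) (x s) <= 4 * e,
    forall s, tau <= s -> s <= b -> mdist (x s) (x b) <= 4 * e &
    mdist (x a) (x b) <= 3 * e -> tau = b].
Proof.
move=> cx ab e0 xe.
have near s : a <= s -> s <= b -> mdist (x a) (x s) <= e \/ mdist (x s) (x b) <= e.
  move=> as_ sb; have := xe a s b (lexx _) as_ sb (lexx _).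
  by rewrite /three_dist ge_min => /orP.
have [abe|abe] := leP (mdist (x a) (x b)) (3 * e).
  exists b; rewrite ab lexx; split => //; last first.
    move=> s bs sb; have -> : s = b by apply/le_anti; rewrite bs sb.
    by rewrite mdistxx mulr_ge0.
  move=> s as_ sb; have [xas|xsb] := near s as_ (ltW sb).
    by rewrite (le_trans xas)// ler_peMl// ler1n.
  have := metric_triangle (x a) (x b) (x s); rewrite (metric_sym (x b)).
  move: xsb abe; move: (mdist _ _) (mdist _ _) (mdist _ _) => u v w; lra.
pose A := [set r : R | exists2 s : {i01 R}, a <= s <= b /\ mdist (x s) (x b) <= e & r = s%:num].
have Ab : A b%:num by exists b; rewrite ?lexx ?(ltW ab) ?mdistxx.
have infA : has_inf A.
  by split; [exists b%:num|exists a%:num => _ [s [/andP[as_ _] _] ->]].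
have a_inf : a%:num <= inf A.
  by apply: lb_le_inf; [exact: infA.1|move=> _ [s [/andP[as_ _] _] ->]].
have inf_b : inf A <= b%:num by apply: ge_inf => //; exact: infA.2.
have a0 : 0 <= a%:num by exact: (i01_ge0 a).
have b1 : b%:num <= 1 by exact: (i01_le1 b).
pose tau : {i01 R} := Itv01 (le_trans a0 a_inf) (le_trans inf_b b1).
have tauE : tau%:num = inf A by [].
have before s : a <= s -> s < tau -> mdist (x a) (x s) <= e.
  move=> as_ st; have sb : s <= b by apply: le_trans (ltW st) inf_b.
  have [//|xsb] := near s as_ sb.
  have : inf A <= s%:num by apply: ge_inf; [exact: infA.2|exists s; rewrite ?as_].
  by rewrite leNgt => /negP; case; exact: st.
have after s : tau < s -> s <= b -> mdist (x s) (x b) <= e.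
  move=> ts sb; have as_ : a <= s by apply: le_trans (a_inf : a <= tau) (ltW ts).
  have s0 : 0 < s%:num - inf A by rewrite subr_gt0; exact: ts.
  have [_ [v [/andP[av vb] xvb] ->]] := inf_adherent s0 infA.
  rewrite addrC subrK => vs; have {}vs : v <= s by exact: ltW.
  have [xas|//] := near s as_ sb.
  have := xe a v s (lexx _) av vs sb; rewrite /three_dist ge_min.
  have h1 := metric_triangle (x a) (x v) (x b).
  have h2 := metric_triangle (x a) (x s) (x v).
  move: h1 h2 xvb xas abe; rewrite (metric_sym (x s) (x v)).
  move: (mdist (x a) (x v)) (mdist (x v) (x b)) (mdist (x a) (x b))
    (mdist (x a) (x s)) (mdist (x v) (x s)) => av' vb' ab' as' vs'.
  exact: arith e0.
(* The infimum [tau] itself is near [x b], by right-continuity. *)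
have at_tau : mdist (x tau) (x b) <= e.
  have [tb|bt] := ltP tau b; last first.
    have -> : tau = b by apply/le_anti; rewrite bt andbT; exact: inf_b.
    by rewrite mdistxx.
  apply/ler_addgt0Pr => f f0; have [h h0 xh] := cadlag_right tau cx f0.
  have tb' : inf A < b%:num by exact: tb.
  pose u := to_i01 (inf A + Num.min (h / 2) (b%:num - inf A)).
  have u0 : 0 < Num.min (h / 2) (b%:num - inf A).
    by rewrite lt_min divr_gt0// subr_gt0.
  have uh : Num.min (h / 2) (b%:num - inf A) < h.
    by rewrite gt_min ltr_pdivrMr// ltr_pMr// ltr1n.
  have ub : Num.min (h / 2) (b%:num - inf A) <= b%:num - inf A.
    by rewrite ge_min lexx orbT.
  have uE : u%:num = inf A + Num.min (h / 2) (b%:num - inf A).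
    apply: clamp_id; move: u0 ub; move: (Num.min _ _) => m *.
    by apply/andP; split; [have := le_trans a0 a_inf|]; lra.
  have tu : tau < u by change (inf A < u%:num); rewrite uE ltrDl.
  have xtu : mdist (x tau) (x u) < f.
    by apply: xh; rewrite uE tauE lerDl (ltW u0)/= ltrD2l.
  rewrite (le_trans (metric_triangle _ (x u) _))// addrC lerD ?(ltW xtu)//.
  by apply: after => //; change (u%:num <= b%:num); rewrite uE -lerBrDl.
have e4 : e <= 4 * e by rewrite ler_peMl// ler1n.
exists tau; split.
- rewrite lt_neqAle (a_inf : a <= tau) (inf_b : tau <= b) !andbT.
  apply/eqP => aE; move: abe; rewrite aE ltNge => /negP; apply.
  by rewrite (le_trans at_tau)// ler_peMl// ler1n.
- by move=> s as_ st; apply: le_trans e4; exact: before.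
- move=> s ts sb; apply: le_trans e4; move: ts; rewrite le_eqVlt => /predU1P[<-//|ts].
  exact: after.
- by [].
Qed.

End window_jump.

Section step_functions.
Context (R : realType) (N : nat) (t : nat -> {i01 R}).
Implicit Types (s u : {i01 R}).
Local Notation i0 := (0%:i01 : {i01 R}).
Local Notation i1 := (1%:i01 : {i01 R}).

Definition step_index s : 'I_N.+1 := inord (\max_(j < N.+1 | t j <= s) j).

Definition step_fun (E : Type) (y : 'I_N.+1 -> E) s : E := y (step_index s).

(** On a small one-sided neighbourhood of [s] the set of knots already passed is
    constant, whatever the order of the knots. *)
Lemma cadlag_step (E : topologicalType) (y : 'I_N.+1 -> E) :
  cadlag (step_fun y).
Proof.
split=> [s s1|s s0].
  suff : \forall u \near nbhs_gt s, forall j : 'I_N.+1, (t j <= u) = (t j <= s).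
    move=> tE; apply: cvg_near_cst; move: tE; apply: filterS => u uE.
    rewrite /step_fun /step_index; congr (y (inord _)).
    by apply: eq_bigl => j; rewrite uE.
  apply: (@filter_forall _ _ (fun (j : 'I_N.+1) u => (t j <= u) = (t j <= s))) => j.
  have [tjs|stj] := leP (t j) s.
    by apply/i01_near; exists 1 => // u _ su; rewrite (le_trans tjs (ltW su)).
  apply/i01_near; exists ((t j)%:num - s%:num); first by rewrite subr_gt0.
  move=> u us su; apply/negbTE; rewrite -ltNge.
  change (u%:num < (t j)%:num); move: us; rewrite ltr_distlC => /andP[_].
  by rewrite addrC subrK.
exists (y (inord (\max_(j < N.+1 | t j < s) j))).
suff : \forall u \near Defs.nbhs_lt s, forall j : 'I_N.+1, (t j <= u) = (t j < s).
  move=> tE; apply: cvg_near_cst; move: tE; apply: filterS => u uE.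
  rewrite /step_fun /step_index; congr (y (inord _)).
  by apply: eq_bigl => j; rewrite uE.
apply: (@filter_forall _ _ (fun (j : 'I_N.+1) u => (t j <= u) = (t j < s))) => j.
have [tjs|stj] := ltP (t j) s; last first.
  apply/i01_near; exists 1 => // u _ us; apply/negbTE; rewrite -ltNge.
  exact: lt_le_trans us stj.
apply/i01_near; exists (s%:num - (t j)%:num); first by rewrite subr_gt0.
move=> u us su; change ((t j)%:num <= u%:num).
by move: us; rewrite ltr_distlC opprB addrC subrK => /andP[/ltW].
Qed.

Definition step_path (y : {ptws 'I_N.+1 -> Dspace R}) : DDspace R :=
  MkDDspace (cadlag_step (y : 'I_N.+1 -> Dspace R)).

Lemma step_path_continuous : continuous step_path.
Proof.
apply: box_continuous => y U /nbhs_metricP[e e0 eU].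
exists (e / 2) => [|z yz]; first by rewrite divr_gt0.
apply: eU; apply: (@le_lt_trans _ _ (e / 2)); last first.
  by rewrite ltr_pdivrMr// ltr_pMr// ltr1n.
apply: (dDD_le (@Lambda_id R)) => [s|s].
  by rewrite subrr normr0 divr_ge0// ltW.
by apply: ltW; exact: yz.
Qed.

Hypothesis t_last : t N = i1.
Hypothesis t_lt : forall i, (i < N)%N -> t i < t i.+1.

Lemma knots_le i j : (i <= j)%N -> (j <= N)%N -> t i <= t j.
Proof.
elim: j => [|j IH]; first by rewrite leqn0 => /eqP ->.
rewrite leq_eqVlt => /predU1P[->//|]; rewrite ltnS => ij jN.
by rewrite (le_trans (IH ij (ltnW jN)))// ltW// t_lt.
Qed.

Lemma step_index_window i s : (i < N)%N -> t i <= s -> s < t i.+1 ->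
  step_index s = inord i.
Proof.
move=> iN tis sti; congr inord; apply/eqP; rewrite eqn_leq; apply/andP; split.
  apply/bigmax_leqP => j tjs; rewrite leqNgt; apply/negP => ij.
  have := lt_le_trans sti (knots_le ij _); rewrite -ltnS ltn_ord.
  by move=> /(_ isT)/(le_lt_trans tjs); rewrite ltxx.
have iN1 : (i < N.+1)%N by rewrite ltnW.
exact: (leq_bigmax_cond (Ordinal iN1)).
Qed.

Lemma step_index_last : step_index i1 = inord N.
Proof.
congr inord; apply/eqP; rewrite eqn_leq; apply/andP; split.
  by apply/bigmax_leqP => j _; rewrite -ltnS.
apply: (@leq_bigmax_cond _ _ _ (@Ordinal N.+1 N (ltnSn N))) => /=.
by rewrite t_last.
Qed.

Lemma window_exists s : t 0%N <= s -> s < i1 ->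
  exists i, [/\ (i < N)%N, t i <= s & s < t i.+1].
Proof.
move=> ts s1; have ex : exists m, s < t m by exists N; rewrite t_last.
case: (ex_minnP ex) => m sm mmin; have mN : (m <= N)%N by apply: mmin; rewrite t_last.
case: m => [|m] in sm mmin mN *; first by move: sm; rewrite ltNge ts.
exists m; split => //; rewrite leNgt; apply/negP => /mmin; by rewrite ltnn.
Qed.

End step_functions.

Section time_change.
Context (R : realType).
Local Notation i0 := (0%:i01 : {i01 R}).
Local Notation i1 := (1%:i01 : {i01 R}).
Implicit Types (s u : {i01 R}).

Lemma clamp_mono : {homo (@clamp R) : r r' / r <= r'}.
Proof.
move=> r r' rr; rewrite /clamp ge_max le_max lexx/= le_max le_min !ge_min lexx rr.
by rewrite !orbT.
Qed.

(** The piecewise linear time change through the points [(tau i, t i)], as a sum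
    of truncated linear functions. *)
Lemma time_change_interpolation (N : nat) (tau t : nat -> {i01 R}) :
  tau 0%N = i0 -> tau N = i1 -> t 0%N = i0 -> t N = i1 ->
  (forall i, (i < N)%N -> tau i < tau i.+1) ->
  (forall i, (i < N)%N -> t i < t i.+1) ->
  exists2 l : {i01 R} -> {i01 R}, Lambda l & forall i, (i <= N)%N -> l (tau i) = t i.
Proof.
move=> tau0 tauN t0 tN tau_lt t_lt.
pose dt i : R := (t i.+1)%:num - (t i)%:num.
pose f i (r : R) := clamp ((r - (tau i)%:num) / ((tau i.+1)%:num - (tau i)%:num)).
pose L (r : R) := \sum_(i < N) dt i * f i r.
have dtau_gt0 i : (i < N)%N -> 0 < (tau i.+1)%:num - (tau i)%:num.
  by move=> iN; rewrite subr_gt0; exact: (tau_lt i iN).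
have dt_gt0 i : (i < N)%N -> 0 < dt i.
  by move=> iN; rewrite subr_gt0; exact: (t_lt i iN).
have f_mono i r r' : (i < N)%N -> r <= r' -> f i r <= f i r'.
  move=> iN rr; apply: clamp_mono; rewrite ler_wpM2r ?lerD2r//.
  by rewrite invr_ge0 ltW// dtau_gt0.
have f0 i r : (i < N)%N -> r <= (tau i)%:num -> f i r = 0.
  move=> iN ri; apply/eqP; rewrite eq_le clamp_ge0 andbT ge_max lexx ge_min.
  by rewrite pmulr_lle0 ?invr_gt0 ?dtau_gt0// subr_le0 ri orbT.
have f1 i r : (i < N)%N -> (tau i.+1)%:num <= r -> f i r = 1.
  move=> iN ri; apply/eqP; rewrite eq_le clamp_le1 le_max le_min lexx.
  by rewrite ler_pdivlMr ?dtau_gt0// mul1r lerB// orbT.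
have f_cont i : continuous (f i).
  move=> r; apply: (@continuous_comp _ _ _
    (fun r => (r - (tau i)%:num) / ((tau i.+1)%:num - (tau i)%:num)) (@clamp R));
    last exact: clamp_continuous.
  by apply: cvgM; [apply: cvgB; [exact: cvg_id|exact: cvg_cst]|exact: cvg_cst].
have L_cont : continuous L.
  apply: continuous_big; first exact: add_continuous.
  by move=> i _ r; apply: cvgM; [exact: cvg_cst|exact: f_cont].
have L_mono r r' : r <= r' -> L r <= L r'.
  move=> rr; apply: ler_sum => i _; rewrite ler_wpM2l ?(ltW (dt_gt0 _ _))//.
  exact: f_mono.
have L_knot j : (j <= N)%N -> L (tau j)%:num = (t j)%:num.
  move=> jN; transitivity (\sum_(i < N) (if (i < j)%N then dt i else 0)).
    apply: eq_bigr => i _; have [ij|ji] := ltnP i j.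
      by rewrite f1 ?mulr1//; apply: (knots_le tau_lt ij jN).
    by rewrite f0 ?mulr0//; apply: (knots_le tau_lt ji); exact: ltnW.
  rewrite -(big_mkord xpredT (fun i => if (i < j)%N then dt i else 0)).
  rewrite (big_cat_nat _ jN)//= [X in _ + X]big1_seq ?addr0; last first.
    move=> i /andP[_]; rewrite mem_index_iota => /andP[ji _].
    by rewrite ltnNge ji.
  rewrite (eq_big_nat _ _ (F2 := dt)); last by move=> i /andP[_ ->].
  by rewrite telescope_sumr// t0 subr0.
have L0 : L 0 = 0 by have := L_knot 0%N (leq0n _); rewrite tau0 t0.
have L1 : L 1 = 1 by have := L_knot N (leqnn _); rewrite tauN tN.
have L01 s : 0 <= L s%:num <= 1.
  by rewrite -{1}L0 -L1 !L_mono.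
pose l s := to_i01 (L s%:num).
have lE s : (l s)%:num = L s%:num by apply: clamp_id.
have l_lt s u : s < u -> l s < l u.
  move=> su; change ((l s)%:num < (l u)%:num); rewrite !lE.
  have [|i [iN tis sti]] := window_exists tauN _ (lt_le_trans su (i01_le1 u)).
    by rewrite tau0; exact: i01_ge0.
  rewrite /L (bigD1 (Ordinal iN))//= [ltRHS](bigD1 (Ordinal iN))//=.
  apply: ltr_leD; last first.
    apply: ler_sum => j _; rewrite ler_wpM2l ?(ltW (dt_gt0 _ _))//.
    by apply: f_mono => //; exact: ltW.
  rewrite ltr_pM2l ?dt_gt0//.
  have sE : f i s%:num = (s%:num - (tau i)%:num) / ((tau i.+1)%:num - (tau i)%:num).
    apply: clamp_id; rewrite divr_ge0 ?(ltW (dtau_gt0 _ _))// ?subr_ge0//=.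
    rewrite ler_pdivrMr ?dtau_gt0// mul1r lerD2r; exact: (ltW sti).
  rewrite {}sE lt_max; apply/orP; right; rewrite lt_min; apply/andP; split.
    by rewrite ltr_pdivrMr ?dtau_gt0// mul1r ltrD2r; exact: sti.
  by rewrite ltr_pM2r ?invr_gt0 ?dtau_gt0// ltrD2r; exact: su.
have l_surj v : exists s, l s = v.
  have [||c /itvP c01 Lc] := @IVT _ L 0 1 v%:num ler01.
  - exact: continuous_subspaceT.
  - by rewrite L0 L1 min_l// max_r//; apply/andP; split;
      [exact: (i01_ge0 v)|exact: (i01_le1 v)].
  exists (to_i01 c); apply: val_inj; rewrite [LHS]lE.
  transitivity (L c); last exact: Lc.
  by congr L; apply: clamp_id; rewrite !c01.
exists l; last by move=> i iN; apply: val_inj; rewrite [LHS]lE; exact: L_knot.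
have l_mono : {mono l : s u / s <= u} by exact: (le_mono l_lt).
split => //; first exact: mono_surj_continuous.
by apply/seteqP; split => // v _; have [s <-] := l_surj v; exists s.
Qed.

(** The step path jumps at [t i.+1], the path [x] essentially at [tau i.+1].  The
    time change with [l (tau i) = t i] matches the jumps, and it moves no time by
    more than two windows. *)
Lemma step_path_close (N : nat) (tau t : nat -> {i01 R}) (x : DDspace R) (c : R) :
  t 0%N = i0 -> t N = i1 -> tau 0%N = i0 -> tau N = i1 ->
  (forall i, (i < N)%N -> t i < tau i.+1 <= t i.+1) ->
  (forall i, (i < N)%N -> 2 * ((t i.+1)%:num - (t i)%:num) <= c) ->
  (forall i s, (i < N)%N -> t i <= s -> s < tau i.+1 -> mdist (x (t i)) (x s) <= c) ->
  (forall i s, (i < N)%N -> tau i.+1 <= s -> s <= t i.+1 ->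
    mdist (x s) (x (t i.+1)) <= c) -> 0 <= c ->
  mdist x (step_path t (fun i : 'I_N.+1 => x (t i))) <= c.
Proof.
move=> t0 tN tau0 tauN tau_t mesh before after c0.
have t_lt i : (i < N)%N -> t i < t i.+1.
  by move=> /tau_t/andP[]; exact: lt_le_trans.
have tau_le i : (i <= N)%N -> tau i <= t i.
  by case: i => [_|i /tau_t/andP[]//]; rewrite t0 tau0.
have tau_lt i : (i < N)%N -> tau i < tau i.+1.
  by move=> iN; apply: (le_lt_trans (tau_le _ (ltnW iN))); have /andP[] := tau_t i iN.
have [l Ll lE] := time_change_interpolation tau0 tauN t0 tN tau_lt t_lt.
have split_at s : s = i1 \/ exists i, [/\ (i < N)%N, tau i <= s & s < tau i.+1].
  have [s1|s1] := ltP s i1; last by left; apply/le_anti; rewrite s1 i01_le1.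
  by right; apply: (window_exists tauN) => //; rewrite tau0 i01_ge0.
have window_l i s : (i < N)%N -> tau i <= s -> s < tau i.+1 ->
    t i <= l s /\ l s < t i.+1.
  move=> iN is_ si; rewrite -(lE i (ltnW iN)) -(lE i.+1 iN).
  by rewrite (Lambda_le _ _ Ll) (Lambda_lt _ _ Ll).
apply: (dDD_le Ll) => s; have [->|[i [iN is_ si]]] := split_at s.
- by rewrite Lambda1// subrr normr0.
- have [h1 h2] := window_l i s iN is_ si.
  have h3 : s%:num < (t i.+1)%:num by apply: lt_le_trans si _; have /andP[] := tau_t i iN.
  have h4 : (t i)%:num <= (l s)%:num by exact: h1.
  have h5 : (l s)%:num < (t i.+1)%:num by exact: h2.
  have h6 : (tau i)%:num <= s%:num by exact: is_.
  have h7 := mesh i iN.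
  have h8 : (t i)%:num - (tau i)%:num <= c / 2.
    case: i iN is_ si h1 h2 h3 h4 h5 h6 h7 => [|i] iN _ _ _ _ _ _ _ _ _.
      by rewrite t0 tau0 subrr divr_ge0.
    have := mesh i (ltnW iN); have /andP[ti _] := tau_t i (ltnW iN).
    have : (t i)%:num <= (tau i.+1)%:num by exact: (ltW ti).
    move: (t i)%:num (t i.+1)%:num (tau i.+1)%:num => *; lra.
  rewrite ler_norml; apply/andP; split;
    move: h3 h4 h5 h6 h7 h8;
    move: (t i)%:num (t i.+1)%:num (tau i)%:num s%:num (l s)%:num => *; lra.
- rewrite Lambda1//= /step_fun (step_index_last tN) inordK// tN.
  by rewrite mdistxx.
- have [h1 h2] := window_l i s iN is_ si.
  rewrite /= /step_fun (step_index_window t_lt iN h1 h2) inordK ?(ltnW iN)//; last first.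
    by rewrite ltnS ltnW.
  have [ts|st] := leP (t i) s; first by rewrite metric_sym; exact: before.
  case: i iN is_ si h1 h2 st => [|i] iN is_ si h1 h2 st.
    by move: st; rewrite ltNge t0 i01_ge0.
  by apply: (after i s (ltnW iN)) => //; exact: ltW.
Qed.

(** In the last window the values at the two ends are close, so that [tau] may be
    taken to be 1 there, as a time change requires. *)
Lemma discretisation_close (S : set {i01 R}) G (rho e c : R) p K (x : DDspace R) :
  gauge G -> dyadic_partitions S G rho p -> 0 <= e ->
  (forall i, (i < 2 ^ K)%N -> forall r s u, p K i <= r -> r <= s -> s <= u ->
    u <= p K i.+1 -> three_dist (x r) (x s) (x u) <= e) ->
  mdist (x (p K (2 ^ K).-1)) (x i1) <= 3 * e ->
  2 * (rho ^+ K * gauge_mass G) <= c -> 4 * e <= c ->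
  mdist x (step_path (p K) (fun i : 'I_(2 ^ K).+1 => x (p K i))) <= c.
Proof.
move=> gG pP e0 xe last_ mesh ec.
have : forall i, exists tau, (i < 2 ^ K)%N -> [/\ p K i < tau <= p K i.+1,
    forall s, p K i <= s -> s < tau -> mdist (x (p K i)) (x s) <= 4 * e,
    forall s, tau <= s -> s <= p K i.+1 -> mdist (x s) (x (p K i.+1)) <= 4 * e &
    mdist (x (p K i)) (x (p K i.+1)) <= 3 * e -> tau = p K i.+1].
  move=> i; have [iK|] := ltnP i (2 ^ K); last by exists (p K i).
  have [tau tauP] := window_jump (@DDspace_cadlag _ x) (part_lt pP iK) e0 (xe i iK).
  by exists tau.
move=> /choice[f fP].
pose tau i := if i is i'.+1 then f i' else p K 0%N.
have K0 : (0 < 2 ^ K)%N by rewrite expn_gt0.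
apply: (@step_path_close _ tau).
- exact: (part_first pP).
- exact: (part_last pP).
- exact: (part_first pP).
- rewrite -(prednK K0) /=; have [|_ _ _ ->] := fP (2 ^ K).-1; rewrite ?prednK//.
    exact: (part_last pP).
  by rewrite (part_last pP).
- by move=> i iK; have [] := fP i iK.
- move=> i iK; apply: le_trans mesh; rewrite ler_pM2l//.
  apply: le_trans (part_gauge pP iK); apply: (gauge_le gG).
  exact: ltW (part_lt pP iK).
- move=> i s iK is_ si; apply: le_trans ec; have [_ h _ _] := fP i iK; exact: h.
- move=> i s iK is_ si; apply: le_trans ec; have [_ _ h _] := fP i iK; exact: h.
- by apply: le_trans ec; rewrite mulr_ge0.
Qed.

End time_change.

(** * Probability of a large oscillation *)

Section chaining_probability.
Context (R : realType).
Local Notation i0 := (0%:i01 : {i01 R}).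
Local Notation i1 := (1%:i01 : {i01 R}).

(** The choice of the ratios for chaining: [rho] is the decay of the gauge
    increments and [theta] that of the distances per level.  The equation says
    that the expected number of bad windows per level decays at rate [theta]; it
    is solvable with [rho] above one half exactly because [2 * alpha > 1]. *)
Lemma chaining_ratios (alpha beta : R) : 2^-1 < alpha -> 0 <= beta ->
  exists rho theta : R, [/\ 2^-1 < rho < 1, 0 < theta < 1 &
    2 * rho `^ (2 * alpha) = theta `^ (4 * beta) * theta].
Proof.
move=> a2 b0; have ln2 : 0 < ln 2 :> R by rewrite ln_gt0// ltr1n.
have b1 : 0 < 4 * beta + 1 by rewrite ltr_wpDl// mulr_ge0.
have a0 : 0 < 2 * alpha by lra.
pose y := - (2^-1 + alpha) / (2 * alpha).
pose x := (2^-1 - alpha) / (4 * beta + 1).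
exists (2 `^ y), (2 `^ x).
have y1 : -1 < y by rewrite /y ltr_pdivlMr//; lra.
have y0 : y < 0 by rewrite /y ltr_pdivrMr// mul0r; lra.
have x0 : x < 0 by rewrite /x ltr_pdivrMr// mul0r; lra.
have pow_lt1 (z : R) : z < 0 -> 2 `^ z < 1.
  move=> z0; rewrite -ltr_ln ?posrE ?powR_gt0// ln1 ln_powR.
  by rewrite pmulr_llt0.
split.
- rewrite pow_lt1// andbT -ltr_ln ?posrE ?powR_gt0 ?invr_gt0//.
  by rewrite lnV ?posrE// ln_powR -mulN1r ltr_pM2r.
- by rewrite powR_gt0// pow_lt1.
- have -> : (2 `^ x) `^ (4 * beta) * 2 `^ x = (2 `^ x) `^ (4 * beta + 1).
    by rewrite powRD ?powRr1 ?powR_ge0// gt_eqF ?powR_gt0// implybT.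
  rewrite -!powRrM -{1}[2]powRr1// -powRD; last by rewrite pnatr_eq0 implybT.
  congr (_ `^ _); rewrite /x /y !divfK ?gt_eqF//; lra.
Qed.

Lemma geometric_tail (theta : R) (K j : nat) : 0 < theta < 1 ->
  \sum_(q < j) theta ^+ (K + q) <= theta ^+ K / (1 - theta).
Proof.
move=> /andP[t0 t1]; rewrite ler_pdivlMr ?subr_gt0//.
have -> : (\sum_(q < j) theta ^+ (K + q)) * (1 - theta) = theta ^+ K * (1 - theta ^+ j).
  under eq_bigr do rewrite exprD.
  rewrite -mulr_sumr -mulrA -[1 - theta ^+ j]opprB subrX1 -mulNr opprB.
  by rewrite [X in _ * X]mulrC.
by rewrite ler_piMr ?exprn_ge0 ?(ltW t0)// gerBl exprn_ge0// ltW.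
Qed.

Context (d : measure_display) (T : measurableType d) (P : probability T R).

(** The moment bound, for times in [S] only and with a constant [C]: this is the
    form that passes to the limit, whose law is controlled at continuity times
    only. *)
Definition three_point_bound (alpha beta C : R) (S : set {i01 R})
    (G : {i01 R} -> R) (Y : T -> DDspace R) : Prop :=
  forall r s t (lambda : R), S r -> S s -> S t -> r <= s -> s <= t -> 0 < lambda ->
    (P [set w | (lambda <= three_dist (Y w r) (Y w s) (Y w t))%R] <=
     (C * ((lambda `^ (4 * beta))^-1 * (G t - G r) `^ (2 * alpha)))%:E)%E.

Context (alpha beta C : R) (S : set {i01 R}) (G : {i01 R} -> R).
Context (rho theta : R) (p : nat -> nat -> {i01 R}).
Hypotheses (a2 : 2^-1 < alpha) (C0 : 0 <= C) (gG : gauge G).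
Hypotheses (rho2 : 2^-1 < rho < 1) (theta01 : 0 < theta < 1).
Hypothesis rho_theta : 2 * rho `^ (2 * alpha) = theta `^ (4 * beta) * theta.
Hypothesis pP : dyadic_partitions S G rho p.

Let theta0 : 0 < theta. Proof. by case/andP: theta01. Qed.
Let rho0 : 0 < rho.
Proof. by case/andP: rho2 => r2 _; apply: lt_trans r2; rewrite invr_gt0. Qed.
Let D : R := C * gauge_mass G `^ (2 * alpha).

Definition level_event (Y : T -> DDspace R) k : set T :=
  \big[setU/set0]_(i < 2 ^ k) [set w | theta ^+ k <=
    three_dist (Y w (p k i)) (Y w (p k.+1 i.*2.+1)) (Y w (p k i.+1))].

Lemma measurable_level_event Y k : random_element Y -> measurable (level_event Y k).
Proof.
by move=> mY; apply: bigsetU_measurable => i _; exact: measurable_three_dist.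
Qed.

(** There are [2 ^ k] windows, each bad with probability at most
    [C * (theta ^+ k) `^ (- 4 * beta) * (rho ^+ k * gauge_mass G) `^ (2 * alpha)];
    the equation between [rho] and [theta] reduces the product to a multiple of
    [theta ^+ k]. *)
Lemma level_event_prob Y k : random_element Y ->
  three_point_bound alpha beta C S G Y ->
  (P (level_event Y k) <= (D * theta ^+ k)%:E)%E.
Proof.
move=> mY bY.
have mA i : (i < 2 ^ k)%N -> measurable [set w | theta ^+ k <=
    three_dist (Y w (p k i)) (Y w (p k.+1 i.*2.+1)) (Y w (p k i.+1))].
  by move=> _; exact: measurable_three_dist.
apply: (le_trans (Boole_inequality P mA)).
pose b : R := C * (((theta ^+ k) `^ (4 * beta))^-1 *
  (rho ^+ k * gauge_mass G) `^ (2 * alpha)).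
apply: (@le_trans _ _ (\sum_(i < 2 ^ k) b%:E)%E).
  apply: lee_sum => i _; have ik := ltn_ord i.
  have ik1 : (i.*2.+1 < 2 ^ k.+1)%N by rewrite expnS mul2n -doubleS leq_double.
  have lt1 : p k i < p k.+1 i.*2.+1.
    by rewrite -(part_refine pP k i); apply: (part_lt pP); exact: ltnW.
  have lt2 : p k.+1 i.*2.+1 < p k i.+1.
    by rewrite -(part_refine pP k i.+1) doubleS; exact: (part_lt pP).
  apply: (le_trans (bY _ _ _ _ _ _ _ (ltW lt1) (ltW lt2) _)).
  - by apply: (part_in pP); exact: ltnW.
  - by apply: (part_in pP); exact: ltnW.
  - exact: (part_in pP).
  - exact: exprn_gt0.
  rewrite lee_fin ler_wpM2l// ler_wpM2l ?invr_ge0 ?powR_ge0//.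
  apply: ge0_ler_powR; rewrite ?nnegrE.
  - by move: a2; lra.
  - by rewrite subr_ge0; apply: (gauge_mono gG); rewrite ltW// (lt_trans lt1).
  - by rewrite mulr_ge0 ?gauge_mass_ge0// exprn_ge0// ltW.
  - exact: (part_gauge pP).
rewrite sumEFin lee_fin sumr_const card_ord -[b *+ _]mulr_natr natrX.
have -> : b * 2 ^+ k = D * theta ^+ k; last exact: lexx.
rewrite /b /D powRM ?exprn_ge0 ?(ltW rho0) ?gauge_mass_ge0//.
have powRX (z e : R) : 0 < z -> (z ^+ k) `^ e = (z `^ e) ^+ k.
  by move=> z0; rewrite -!powR_mulrn ?powR_ge0 ?(ltW z0)// powRAC.
rewrite !powRX//.
have tb : (theta `^ (4 * beta)) ^+ k != 0.
  by rewrite expf_neq0// gt_eqF// powR_gt0.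
have : (2 * rho `^ (2 * alpha)) ^+ k = (theta `^ (4 * beta) * theta) ^+ k.
  by rewrite rho_theta.
rewrite !exprMn => h.
rewrite -!mulrA; congr (_ * _).
rewrite (mulrCA ((rho `^ _) ^+ k)) [_ * 2 ^+ k]mulrC h mulrCA.
by rewrite mulKf.
Qed.

Definition bad_event (Y : T -> DDspace R) K : set T :=
  \bigcup_j level_event Y (K + j).

Lemma bad_event_prob Y K : random_element Y ->
  three_point_bound alpha beta C S G Y ->
  (P (bad_event Y K) <= (D * (theta ^+ K / (1 - theta)))%:E)%E.
Proof.
move=> mY bY; have mL k := measurable_level_event k mY.
apply: (le_trans (generalized_Boole_inequality P _ _)) => //.
  exact: bigcupT_measurable.
apply: lime_le; first by apply: is_cvg_nneseries => n _ _; exact: measure_ge0.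
apply: nearW => n; rewrite big_mkord.
apply: (@le_trans _ _ (\sum_(j < n) (D * theta ^+ (K + j))%:E)%E).
  by apply: lee_sum => j _; exact: level_event_prob.
rewrite sumEFin lee_fin -mulr_sumr ler_wpM2l ?geometric_tail//.
by rewrite mulr_ge0 ?powR_ge0.
Qed.

(** The partition level [K] depends on the constants of the moment bound but not
    on the process, so one [K] serves the whole sequence and its limit. *)
Lemma discretisation_probability (e : R) : 0 < e ->
  \forall K \near \oo, forall Y, random_element Y ->
    three_point_bound alpha beta C S G Y -> exists B, [/\ measurable B,
      (P B <= e%:E)%E & forall w, ~ B w ->
        mdist (Y w (p K (2 ^ K).-1)) (Y w i1) <= e / 2 ->
        mdist (Y w) (step_path (p K) (fun i : 'I_(2 ^ K).+1 => Y w (p K i))) <= e].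
Proof.
move=> e0; have [_ rho1] := andP rho2; have [_ theta1] := andP theta01.
have cvg0 (z c : R) : 0 < z < 1 -> z ^+ n * c @[n --> \oo] --> 0.
  move=> /andP[z0 z1]; rewrite -(mul0r c); apply: cvgM; last exact: cvg_cst.
  by apply: cvg_expr; rewrite ger0_norm// ltW.
have lt_near (z c h : R) : 0 < z < 1 -> 0 < h ->
    \forall n \near \oo, z ^+ n * c <= h.
  by move=> z01 h0; apply: (cvgr_le _ (cvg0 z c z01)).
near=> K => Y mY bY; exists (bad_event Y K); split.
- by apply: bigcupT_measurable => j; exact: measurable_level_event.
- apply: (le_trans (bad_event_prob K mY bY)); rewrite lee_fin mulrCA.
  by near: K; exact: lt_near.
move=> w nB lastw.
apply: (discretisation_close (e := e / 4) gG pP).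
- by rewrite divr_ge0// ltW.
- move=> i iK; apply: (window_three_dist (eps := fun k => theta ^+ k) gG _ pP) => //.
  + by rewrite (ltW rho0).
  + exact: DDspace_cadlag.
  + by move=> k; rewrite exprn_ge0// ltW.
  + move=> j; apply: (@le_trans _ _ (theta ^+ K * (2 / (1 - theta)))).
      by rewrite mulrCA ler_wpM2l// geometric_tail.
    by near: K; apply: lt_near => //; rewrite divr_gt0.
  + move=> k l Kk lk; apply/ltW; rewrite ltNge; apply/negP => bad; apply: nB.
    exists (k - K)%N => //; rewrite subnKC// /level_event.
    by rewrite (bigD1 (Ordinal lk))//=; left.
- by apply: (le_trans lastw); lra.
- rewrite mulrCA; near: K; apply: lt_near => //; by rewrite rho0.
- by rewrite mulrC divfK.
Unshelve. all: by end_near. Qed.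

End chaining_probability.

(** * The convergence criterion *)

Section finite_dimensional_convergence.
Context (R : realType) (d : measure_display) (T : measurableType d).
Context (P : probability T R).
Local Notation i0 := (0%:i01 : {i01 R}).
Local Notation i1 := (1%:i01 : {i01 R}).

Lemma cvg_in_distribution_comp (E E' : ptopologicalType) (Y_ : nat -> T -> E)
    (Y : T -> E) (h : E -> E') :
  (forall n, random_element (Y_ n)) -> random_element Y -> continuous h ->
  cvg_in_distribution P Y_ Y ->
  cvg_in_distribution P (fun n => h \o Y_ n) (h \o Y).
Proof.
move=> mY_ mY ch /(cvg_in_distributionP P mY_ mY) YY.
apply/cvg_in_distributionP => [n||f cf /bounded_fun_bound[M _ fM]].
- exact: random_element_comp.
- exact: random_element_comp.
- apply: (YY (f \o h)); last by apply: (@bounded_fun_le _ _ _ M) => y; exact: fM.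
  by move=> y; apply: continuous_comp; [exact: ch|exact: cf].
Qed.

Lemma gauge_of_homo (F : {i01 R} -> R) : {homo F : s t / s <= t} -> continuous F ->
  gauge (fun t => F t + t%:num).
Proof.
move=> hF cF; split.
  move=> t; apply: (cvgD (cF t)).
  by apply/cvgrPdist_lt => e e0; apply/i01_near; exists e.
by move=> s t st; have := hF s t st; move: (F s) (F t) => a b; lra.
Qed.

Context (Y_ : nat -> T -> DDspace R) (Y : T -> DDspace R).
Hypotheses (mY_ : forall n, random_element (Y_ n)) (mY : random_element Y).
Hypothesis fidi : forall (k : nat) (t : 'I_k -> {i01 R}), (0 < k)%N ->
  (forall i, continuity_times P Y (t i)) ->
  cvg_in_distribution P
    (fun n w => (fun i => Y_ n w (t i)) : {ptws 'I_k -> Dspace R})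
    (fun w => (fun i => Y w (t i)) : {ptws 'I_k -> Dspace R}).

Let cvg_triple r s t : continuity_times P Y r -> continuity_times P Y s ->
  continuity_times P Y t -> cvg_in_distribution P
    (fun n w => (fun i => Y_ n w (triple r s t i)) : {ptws 'I_3 -> Dspace R})
    (fun w => (fun i => Y w (triple r s t i)) : {ptws 'I_3 -> Dspace R}).
Proof. by move=> Tr Ts Tt; apply: fidi => // -[[|[|[|//]]] i3]. Qed.

Section oscillation_bound.
Context (alpha beta : R) (F : {i01 R} -> R).
Hypotheses (a2 : 2^-1 < alpha) (b0 : 0 <= beta).
Hypothesis hF : {homo F : s t / s <= t}.
Hypothesis osc_F : forall r s t (lambda : R) n,
  r <= s -> s <= t -> 0 < lambda -> (1 <= n)%N ->
  (P [set w | (lambda <= three_dist (Y_ n w r) (Y_ n w s) (Y_ n w t))%R] <=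
   ((lambda `^ (4 * beta))^-1 * (F t - F r) `^ (2 * alpha))%:E)%E.

Let G (t : {i01 R}) := F t + t%:num.
Let C : R := 2 `^ (4 * beta).

Let b40 : 0 <= 4 * beta. Proof. by rewrite mulr_ge0. Qed.

Let F_le_G r t : r <= t -> (F t - F r) `^ (2 * alpha) <= (G t - G r) `^ (2 * alpha).
Proof.
move=> rt; have rt' : r%:num <= t%:num by exact: rt.
have := hF rt; rewrite /G; move: (F r) (F t) => a b ab.
apply: ge0_ler_powR; rewrite ?nnegrE; move: a2; lra.
Qed.

Lemma three_point_bound_sequence n : (1 <= n)%N ->
  three_point_bound P alpha beta C (continuity_times P Y) G (Y_ n).
Proof.
move=> n1 r s t lambda _ _ _ rs st l0; apply: le_trans (osc_F rs st l0 n1) _.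
have C1 : 1 <= C.
  have le12 : 1 <= 2 :> R by rewrite ler1n.
  by have := ler_powR le12 b40; rewrite powRr0.
rewrite lee_fin (@le_trans _ _ ((lambda `^ (4 * beta))^-1 * (G t - G r) `^ (2 * alpha)))//.
  by rewrite ler_wpM2l ?invr_ge0 ?powR_ge0// F_le_G// (le_trans rs).
by rewrite ler_peMl// mulr_ge0 ?invr_ge0 ?powR_ge0.
Qed.

(** Events with a non-strict inequality pass to the limit at the price of a
    smaller threshold, here [lambda / 2]; this is where the constant
    [2 `^ (4 * beta)] comes from. *)
Lemma three_point_bound_limit :
  three_point_bound P alpha beta C (continuity_times P Y) G Y.
Proof.
move=> r s t lambda Tr Ts Tt rs st l0.
have l20 : 0 < lambda / 2 by rewrite divr_gt0.
have ll : lambda / 2 < lambda by rewrite ltr_pdivrMr// ltr_pMr// ltr1n.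
apply: (tail_limit_le (@three_dist_at_continuous R (Dspace R)) ll
  (fun n => random_element_eval (mY_ n) (triple r s t))
  (random_element_eval mY (triple r s t)) (cvg_triple Tr Ts Tt)).
exists 1%N => // n /= n1; apply: le_trans (osc_F rs st l20 n1) _.
have CE : ((lambda / 2) `^ (4 * beta))^-1 = C * (lambda `^ (4 * beta))^-1.
  have i2 : 0 <= 2^-1 :> R by rewrite invr_ge0.
  rewrite powRM ?(ltW l0)// invfM mulrC; congr (_ * _).
  rewrite /C -powRN -[2^-1]powR_inv1// -powRrM; congr (_ `^ _).
  by rewrite mulN1r opprK.
rewrite lee_fin CE -mulrA ler_wpM2l ?powR_ge0// ler_wpM2l ?invr_ge0 ?powR_ge0//.
by rewrite F_le_G// (le_trans rs).
Qed.

End oscillation_bound.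
End finite_dimensional_convergence.

Section convergence.
Context (R : realType) (d : measure_display) (T : measurableType d).
Context (P : probability T R).
Local Notation i0 := (0%:i01 : {i01 R}).
Local Notation i1 := (1%:i01 : {i01 R}).
Context (Y_ : nat -> T -> DDspace R) (Y : T -> DDspace R).
Hypotheses (mY_ : forall n, random_element (Y_ n)) (mY : random_element Y).
Hypothesis fidi : forall (k : nat) (t : 'I_k -> {i01 R}), (0 < k)%N ->
  (forall i, continuity_times P Y (t i)) ->
  cvg_in_distribution P
    (fun n w => (fun i => Y_ n w (t i)) : {ptws 'I_k -> Dspace R})
    (fun w => (fun i => Y w (t i)) : {ptws 'I_k -> Dspace R}).
Hypothesis left_cont1 : forall eps : R, 0 < eps ->
  P [set w | eps <= dJ1 (Y w 1%:i01) (Y w (1 - delta%:num)%:i01)]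
    @[delta --> nbhs_gt (0%:i01 : {i01 R})] --> 0%E.

Lemma dist_limit_lt s t (a b q : R) : a < b ->
  continuity_times P Y s -> continuity_times P Y t ->
  (P [set w | (a <= mdist (Y w t) (Y w s))%R] < q%:E)%E ->
  \forall n \near \oo, (P [set w | (b <= mdist (Y_ n w s) (Y_ n w t))%R] < q%:E)%E.
Proof.
move=> ab Ts Tt Pq.
have distE (Z : T -> DDspace R) c :
    [set w | c <= mdist (Z w s) (Z w t)] =
    [set w | c <= three_dist_at (fun i => Z w (triple s t s i))].
  by apply/seteqP; split=> w /=; rewrite /three_dist_at /three_dist/= (metric_sym (Z w t)) minxx.
have cvg3 : cvg_in_distribution P
    (fun n w => (fun i => Y_ n w (triple s t s i)) : {ptws 'I_3 -> Dspace R})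
    (fun w => (fun i => Y w (triple s t s i)) : {ptws 'I_3 -> Dspace R}).
  by apply: fidi => // -[[|[|[|//]]] i3].
have := tail_limit_lt (@three_dist_at_continuous R (Dspace R)) ab
  (fun n => random_element_eval (mY_ n) (triple s t s))
  (random_element_eval mY (triple s t s)) cvg3.
move=> /(_ q) lim_lt.
have {}lim_lt : \forall n \near \oo, (P [set w |
    (b <= three_dist_at (fun i => Y_ n w (triple s t s i)))%R] < q%:E)%E.
  apply: lim_lt; rewrite -distE.
  by under eq_set do rewrite metric_sym.
by move: lim_lt; apply: filterS => n; rewrite -distE.
Qed.

Context (alpha beta : R) (F : {i01 R} -> R).
Hypotheses (a2 : 2^-1 < alpha) (b0 : 0 <= beta).
Hypotheses (hF : {homo F : s t / s <= t}) (cF : continuous F).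
Hypothesis osc_F : forall r s t (lambda : R) n,
  r <= s -> s <= t -> 0 < lambda -> (1 <= n)%N ->
  (P [set w | (lambda <= three_dist (Y_ n w r) (Y_ n w s) (Y_ n w t))%R] <=
   ((lambda `^ (4 * beta))^-1 * (F t - F r) `^ (2 * alpha))%:E)%E.

Lemma three_point_cvg_in_distribution : cvg_in_distribution P Y_ Y.
Proof.
(* Adding the identity to [F] makes it strictly increasing, which dyadic
   partitions with small gauge increments need to have small mesh. *)
pose G (t : {i01 R}) := F t + t%:num; pose S := continuity_times P Y.
have gG : gauge G := gauge_of_homo hF cF.
have S1 : S i1 by exact: continuity_times1.
have dS s t : s < t -> exists2 u, S u & s < u < t.
  by move=> st; exact: continuity_times_dense.
have [rho [theta [rho01 theta01 rho_theta]]] := chaining_ratios a2 b0.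
have [rho2 rho1] := andP rho01.
have [p pP] := dyadic_partitions_exist gG dS (continuity_times0 P Y) S1 rho2.
have C0 : 0 <= 2 `^ (4 * beta) :> R by exact: powR_ge0.
apply: converging_together => // e e0.
have e20 : 0 < e / 2 by rewrite divr_gt0.
have e80 : 0 < e / 8 by rewrite divr_gt0.
(* The threshold grows from [e / 8] to [e / 4] when passing from the limit to
   the sequence. *)
have [h h0 hP] := left_cont1_near left_cont1 e80 e20.
have discr := discretisation_probability P a2 C0 gG rho01 theta01 rho_theta pP e20.
have [K [discrK lastK]] : exists K, (forall Z, random_element Z ->
    three_point_bound P alpha beta (2 `^ (4 * beta)) S G Z -> exists B, [/\ measurable B,
      (P B <= (e / 2)%:E)%E & forall w, ~ B w ->
        mdist (Z w (p K (2 ^ K).-1)) (Z w i1) <= e / 2 / 2 ->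
        mdist (Z w) (step_path (p K) (fun i : 'I_(2 ^ K).+1 => Z w (p K i))) <= e / 2])
    /\ 1 - h < (p K (2 ^ K).-1)%:num.
  have rho0 : 0 < rho by apply: lt_trans rho2; rewrite invr_gt0.
  have : rho ^+ K * gauge_mass G @[K --> \oo] --> 0.
    rewrite -(mul0r (gauge_mass G)); apply: cvgM; last exact: cvg_cst.
    by apply: cvg_expr; rewrite ger0_norm// ltW.
  move=> /cvgr_lt/(_ _ h0) mesh.
  have [K _ /(_ K (leqnn K)) [discrK meshK]] := filterI discr mesh.
  exists K; split; first exact: discrK.
  have K1 : ((2 ^ K).-1 < 2 ^ K)%N by rewrite ltn_predL expn_gt0.
  have := gauge_le gG (ltW (part_lt pP K1)).
  have := part_gauge pP K1; rewrite prednK ?expn_gt0// (part_last pP).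
  move=> h1 h2; have := le_lt_trans (le_trans h2 h1) meshK.
  by rewrite ltrBlDl addrC -ltrBlDl.
pose s := p K (2 ^ K).-1.
have K1 : ((2 ^ K).-1 < 2 ^ K)%N by rewrite ltn_predL expn_gt0.
have s1 : s < i1 by have := part_lt pP K1; rewrite prednK ?expn_gt0// (part_last pP).
have Ss : S s by apply: (part_in pP); exact: ltnW.
have Plast := hP s; rewrite lastK /= in Plast.
have {}Plast := Plast s1.
pose A : {ptws 'I_(2 ^ K).+1 -> Dspace R} -> DDspace R := @step_path R (2 ^ K) (p K).
pose ev (x : DDspace R) : {ptws 'I_(2 ^ K).+1 -> Dspace R} := fun i => x (p K i).
have mev Z : random_element Z -> random_element (ev \o Z).
  by move=> mZ; exact: (random_element_eval mZ (fun i : 'I_(2 ^ K).+1 => p K i)).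
have cA : continuous A by exact: step_path_continuous.
have close Z : random_element Z ->
    three_point_bound P alpha beta (2 `^ (4 * beta)) S G Z ->
    (P [set w | (e / 4 <= mdist (Z w s) (Z w i1))%R] <= (e / 2)%:E)%E ->
    exists B, [/\ measurable B, (P B <= e%:E)%E &
      forall w, ~ B w -> mdist (Z w) (A (ev (Z w))) <= e].
  move=> mZ bZ lZ; have [B [mB PB BZ]] := discrK Z mZ bZ.
  have mL := measurable_dist mZ (e / 4) s i1.
  exists (B `|` [set w | e / 4 <= mdist (Z w s) (Z w i1)]); split.
  - exact: measurableU.
  - rewrite [X in (_ <= X%:E)%E](splitr e) EFinD; apply: le_trans (leeD PB lZ).
    exact: measureU2.
  - move=> w /not_orP[nB /negP]; rewrite -ltNge => nL.
    apply: (@le_trans _ _ (e / 2)); last by rewrite ler_pdivrMr// ler_pMr// ler1n.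
    by apply: BZ => //; apply: (le_trans (ltW nL)); lra.
exists (fun n => A \o (ev \o Y_ n)), (A \o (ev \o Y)); split.
- by move=> n; apply: random_element_comp => //; exact: mev.
- by apply: random_element_comp => //; exact: mev.
- apply: cvg_in_distribution_comp => //; [by move=> n; exact: mev|exact: mev|].
  by apply: fidi => // i; apply: (part_in pP); rewrite -ltnS.
- have e84 : e / 8 < e / 4 by lra.
  have lim := dist_limit_lt e84 Ss S1 Plast.
  near=> n; apply: close => //.
    by apply: three_point_bound_sequence => //; near: n; exists 1%N.
  by apply: ltW; near: n; exact: lim.
- apply: close => //.
    by apply: three_point_bound_limit.
  apply: le_trans (ltW Plast); apply: le_measure; rewrite ?inE.
  + exact: measurable_dist.
  + exact: measurable_dist.
  + by move=> w /=; rewrite metric_sym; apply: le_trans; lra.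
Unshelve. all: by end_near. Qed.

End convergence.

Theorem theorem4p3 (R : realType) (d : measure_display) (Omega : measurableType d)
    (P : probability Omega R)
    (X_ : nat -> {mfun Omega >-> borelType (DDspace R)})
    (X : {mfun Omega >-> borelType (DDspace R)}) :
  let x_ n w : DDspace R := X_ n w in
  let x w : DDspace R := X w in
  let T_X := [set t : {i01 R} | P [set w | x w t = left_limit (x w) t] = 1%E] in
  (forall (k : nat) (t : 'I_k -> {i01 R}), (0 < k)%N -> (forall i, T_X (t i)) ->
    cvg_in_distribution P
      (fun n w => (fun i => x_ n w (t i)) : {ptws 'I_k -> Dspace R})
      (fun w => (fun i => x w (t i)) : {ptws 'I_k -> Dspace R})) ->
  (forall eps : R, 0 < eps ->
    P [set w | eps <= dJ1 (x w 1%:i01) (x w (1 - delta%:num)%:i01)]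
      @[delta --> nbhs_gt (0%:i01 : {i01 R})] --> 0%E) ->
  (forall eps : R, 0 < eps ->
    [/\ limn_esup (fun n => outer_prob P
          [set w | exists t, (eps%:E <= w'' (x_ n w t) delta%:num)%E])
          @[delta --> nbhs_gt (0%:i01 : {i01 R})] --> 0%E,
        limn_esup (fun n => outer_prob P
          [set w | exists t, eps <= `|x_ n w t delta - x_ n w t 0%:i01|])
          @[delta --> nbhs_gt (0%:i01 : {i01 R})] --> 0%E &
        limn_esup (fun n => outer_prob P
          [set w | exists t, eps <= `|left_limit (x_ n w t) 1%:i01
                                      - x_ n w t (1 - delta%:num)%:i01|])
          @[delta --> nbhs_gt (0%:i01 : {i01 R})] --> 0%E]) ->
  (exists (alpha beta : R) (F : {i01 R} -> R),
    [/\ 2^-1 < alpha, 0 <= beta, {homo F : s t / s <= t}, continuous F &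
      forall (r s t : {i01 R}) (lambda : R) (n : nat),
        r <= s -> s <= t -> 0 < lambda -> (1 <= n)%N ->
        (P [set w | (lambda <= Num.min (dJ1 (x_ n w r) (x_ n w s))
                                      (dJ1 (x_ n w s) (x_ n w t)))%R]
         <= ((lambda `^ (4 * beta))^-1 * (F t - F r) `^ (2 * alpha))%:E)%E]) ->
  cvg_in_distribution P x_ x.
Proof.
move=> x_ x T_X fidi left_cont1 _ [alpha [beta [F [a2 b0 hF cF osc]]]].
have mx_ n : random_element (x_ n) by exact: measurable_funP.
have mx : random_element x by exact: measurable_funP.
exact: (three_point_cvg_in_distribution mx_ mx fidi left_cont1 a2 b0 hF cF osc).
Qed.
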